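(* Suppose that $\mathbb P$ is asymptotically decoupled and that $K^{\bar\sigma}$ is a corresponding translation invariant joint measure of a quenched random system with a finite range defining potential $\Phi$. Then $h(K|K^{\bar\sigma})$ exists for all translation invariant probability measures $K$ on the joint configuration space.
   Context: $E,E'$ are finite sets. Spin configurations are $\sigma\in E^{\mathbb Z^d}$, disorder configurations are $\eta\in(E')^{\mathbb Z^d}$, joint configurations are $\xi=(\sigma,\eta)=(\sigma_x,\eta_x)_{x\in\mathbb Z^d}$. The defining potential is a family $\Phi=(\Phi_A)$ of real functions indexed by finite $A\subset\mathbb Z^d$, with $\Phi_A(\xi)$ depending on $\xi$ only through $\xi_A$; it is finite range, i.e. there is $r<\infty$ with $\Phi_A=0$ whenever $\mathrm{diam}(A)>r$. For fixed $\eta$, finite $\Lambda$ and boundary condition $\bar\sigma\in E^{\mathbb Z^d}$ the quenched finite-volume Gibbs measure is $$\mu_\Lambda^{\bar\sigma}[\eta](B)=\frac1{Z_\Lambda^{\bar\sigma}[\eta]}\sum_{\sigma_\Lambda\in E^\Lambda}1_B(\sigma_\Lambda\bar\sigma_{\mathbb Z^d\setminus\Lambda})\exp\Big(-\sum_{A:A\cap\Lambda\ne\emptyset}\Phi_A(\sigma_\Lambda\bar\sigma_{\mathbb Z^d\setminus\Lambda},\eta)\Big).$$ $\mathbb P$ is a probability measure on $(E')^{\mathbb Z^d}$. A joint measure $K^{\bar\sigma}$ is any weak limit (product topology), along a sequence of finite volumes $\Lambda_N\uparrow\mathbb Z^d$, of the measures $\mathbb P(d\eta)\mu_{\Lambda_N}^{\bar\sigma}[\eta](d\sigma)$.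 $\Lambda_n=[-n,n]^d\cap\mathbb Z^d$; $\mathcal F_\Lambda$ is the $\sigma$-field generated by the coordinates in $\Lambda$. A translation invariant probability measure $\mathbb P$ is asymptotically decoupled if there are sequences $g_n,c_n$ with $\lim_n c_n/|\Lambda_n|=0$, $\lim_n g_n/n=0$, such that for all $A\in\mathcal F_{\Lambda_n}$, $B\in\mathcal F_{\Lambda_{n+g_n}^c}$ with $\mathbb P(A)\mathbb P(B)\neq0$, $e^{-c_n}\le\frac{\mathbb P(A\cap B)}{\mathbb P(A)\mathbb P(B)}\le e^{c_n}$. $h(K|K')=\lim_{n\to\infty}|\Lambda_n|^{-1}h_{\Lambda_n}(K|K')$, where $h_\Lambda(K|K')=\sum_{\xi_\Lambda}K(\xi_\Lambda)\log\frac{K(\xi_\Lambda)}{K'(\xi_\Lambda)}$ if the marginal of $K$ on $\Lambda$ is absolutely continuous with respect to that of $K'$, and $+\infty$ otherwise. *)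

(* Defs.v *)
From HB Require Import structures.
From mathcomp Require Import all_boot all_order all_algebra finmap zify.
From mathcomp Require Import all_classical all_reals all_analysis.
From mathcomp Require Import measurable_realfun.

Set Implicit Arguments.
Unset Strict Implicit.
Unset Printing Implicit Defensive.

Import Order.TTheory GRing.Theory Num.Theory.
Import numFieldNormedType.Exports.

Local Open Scope classical_set_scope.
Local Open Scope ring_scope.

(* MathComp-Analysis measurable types are pointed, so the finite single-site
   spaces carry a distinguished point; it plays no mathematical role. *)
#[short(type="pfinType")]
HB.structure Definition PointedFinite := {T of Finite T & Pointed T}.

HB.instance Definition _ (S T : pfinType) := Pointed.on (S * T)%type.

Section Lattice.
Variable d : nat.

Local Notation site := 'rV[int]_d.

Definition dist (x y : site) : nat := \max_(i < d) `|x 0%R i - y 0%R i|%N.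

Definition diam (A : {fset site}) : nat :=
  \max_(x <- enum_fset A) \max_(y <- enum_fset A) dist x y.

Definition box (n : nat) : {fset site} :=
  [fset \row_i (((f : {ffun 'I_d -> 'I_(n + n).+1}) i : nat)%:Z - n%:Z)
    | f in {ffun 'I_d -> 'I_(n + n).+1}]%fset.

Lemma in_box (n : nat) (x : site) :
  (x \in box n) = [forall i, (`|x 0%R i| <= n)%N].
Proof.
apply/imfsetP/forallP => [[f _ ->] i|xn].
  by rewrite mxE; case: (f i) => m mn; rewrite -[nat_of_ord _]/m; lia.
have e i : (absz (x 0%R i + n%:Z)%R < (n + n).+1)%N.
  by have := xn i; move: (x 0%R i) => z; lia.
exists [ffun i => Ordinal (e i)] => //.
by apply/rowP => i; rewrite mxE ffunE /=; have := xn i; move: (x 0 i) => z; lia.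
Qed.

End Lattice.


Local Notation site d := 'rV[int]_d.

Section Configurations.
Variables (d : nat) (S : pfinType).

Definition coord_events (X : set (site d)) : set (set (site d -> S)) :=
  [set B | exists x a, X x /\ B = [set xi | xi x = a]].

Definition config : Type := g_sigma_algebraType (coord_events setT).
HB.instance Definition _ := Pointed.copy config (site d -> S).
HB.instance Definition _ :=
  Topological.copy config (prod_topology (fun _ : site d => discrete_topology S)).
HB.instance Definition _ :=
  Measurable.copy config (g_sigma_algebraType (coord_events setT)).

Definition sigma_field (X : set (site d)) : set (set config) :=
  <<s coord_events X >>.

Definition shift (z : site d) (xi : config) : config := fun x => xi (x + z).

Definition cylinder (L : {fset site d}) (s : {ffun L -> S}) : set config :=
  [set xi | forall x : L, xi (fsval x) = s x].

Definition glue (L : {fset site d}) (s : {ffun L -> S}) (xi : config) : config :=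
  fun x => if insub x is Some u then s u else xi x.

End Configurations.

Section ConfigurationsTheory.
Variables (d : nat) (S : pfinType).

Lemma measurable_coord (x : site d) (a : S) :
  measurable [set xi : config d S | xi x = a].
Proof. by apply: sub_sigma_algebra; exists x, a. Qed.

Lemma measurable_cylinder (L : {fset site d}) (s : {ffun L -> S}) :
  measurable (cylinder s).
Proof.
rewrite (_ : cylinder s =
  \bigcap_(x in [set: L]) [set xi : config d S | xi (fsval x) = s x]); last first.
  by apply/seteqP; split=> [xi h x _|xi h x]; exact: h.
by apply: fin_bigcap_measurable => // x _; exact: measurable_coord.
Qed.

Lemma measurable_local (d' : measure_display) (T : measurableType d')
    (L : {fset site d}) (f : config d S -> T) :
  (forall xi xi' : config d S,
    (forall x, x \in L -> xi x = xi' x) -> f xi = f xi') ->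
  measurable_fun setT f.
Proof.
move=> fL _ Y _; rewrite setTI.
rewrite (_ : f @^-1` Y =
  \bigcup_(s in [set s : {ffun L -> S} | Y (f (glue s point))]) cylinder s).
  by apply: fin_bigcup_measurable => // s _; exact: measurable_cylinder.
have fE (s : {ffun L -> S}) xi : cylinder s xi -> f xi = f (glue s point).
  move=> sxi; apply: fL => x xL; rewrite /glue insubT.
  by rewrite -sxi.
apply/seteqP; split=> [xi Yxi|xi [s /= Ys sxi]]; last by rewrite /= (fE s).
by exists [ffun x => xi (fsval x)] => [/=|x]; rewrite -?(fE _ xi) ?ffunE// => x;
  rewrite ffunE.
Qed.

End ConfigurationsTheory.

Section QuenchedSystem.
Variables (R : realType) (d : nat) (E E' : pfinType).

Definition joint (sigma : config d E) (eta : config d E') :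
    config d (E * E')%type :=
  fun x => (sigma x, eta x).

Lemma measurable_jointr sigma : measurable_fun setT (joint sigma).
Proof.
apply: measurability => //; rewrite /preimage_set_system.
move=> _ [_ [x [[a b] [_ ->]]] <-]; rewrite setTI.
have [ax|ax] := eqVneq (sigma x) a; last first.
  rewrite (_ : _ @^-1` _ = set0)//.
  by apply/seteqP; split => // eta /= [] /eqP; rewrite (negbTE ax).
rewrite (_ : _ @^-1` _ = [set eta : config d E' | eta x = b]).
  exact: measurable_coord.
by apply/seteqP; split => eta /=; rewrite /joint; [case|move=> ->; rewrite ax].
Qed.

Lemma measurable_jointl eta : measurable_fun setT (joint ^~ eta).
Proof.
apply: measurability => //; rewrite /preimage_set_system.
move=> _ [_ [x [[a b] [_ ->]]] <-]; rewrite setTI.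
have [bx|bx] := eqVneq (eta x) b; last first.
  rewrite (_ : _ @^-1` _ = set0)//.
  by apply/seteqP; split => // sigma /= [_] /eqP; rewrite (negbTE bx).
rewrite (_ : _ @^-1` _ = [set sigma : config d E | sigma x = a]).
  exact: measurable_coord.
by apply/seteqP; split => sigma /=; rewrite /joint; [case|move=> ->; rewrite bx].
Qed.

Record finite_range_potential := FiniteRangePotential {
  pot :> {fset site d} -> config d (E * E')%type -> R;
  pot_local : forall (A : {fset site d}) (xi xi' : config d (E * E')%type),
    (forall x, x \in A -> xi x = xi' x) -> pot A xi = pot A xi';
  pot_finite_range : exists r : nat,
    forall A : {fset site d}, (r < diam A)%N ->
    forall xi : config d (E * E')%type, pot A xi = 0 }.

Section FiniteVolume.
Variables (Phi : finite_range_potential) (L : {fset site d}).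
Variable bc : config d E.

(* A finitely supported sum: see [energy_finite_support]. *)
Definition energy (xi : config d (E * E')%type) : R :=
  \sum_(A \in [set A : {fset site d} | (A `&` L)%fset != fset0]) Phi A xi.

Definition boltzmann (eta : config d E') (s : {ffun L -> E}) : R :=
  expR (- energy (joint (glue s bc) eta)).

Definition partition_function (eta : config d E') : R :=
  \sum_(s : {ffun L -> E}) boltzmann eta s.

Definition gibbs (eta : config d E') (B : set (config d E)) : R :=
  (partition_function eta)^-1 *
  \sum_(s : {ffun L -> E}) \1_B (glue s bc) * boltzmann eta s.

Lemma interaction_neighborhood : exists N : {fset site d},
  forall A : {fset site d}, (A `&` L)%fset != fset0 ->
    (A `<=` N)%fset \/ (forall xi, Phi A xi = 0).
Proof.
have [r Phi0] := pot_finite_range Phi.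
exists [fset (x + y)%R | x in L, y in box d r]%fset => A.
move=> /fset0Pn[x]; rewrite inE => /andP[xA xL].
case: (ltnP r (diam A)) => [rA|Ar]; [by right=> xi; rewrite Phi0|left].
apply/fsubsetP => y yA; apply/imfset2P.
exists x => //; exists (y - x); last by rewrite addrC subrK.
rewrite in_box; apply/forallP => i; rewrite !mxE.
apply: leq_trans Ar; apply: (@leq_trans (dist y x)).
  exact: (leq_bigmax (F := fun i => `|y 0%R i - x 0%R i|%N)).
rewrite /diam (big_rem y)//= leq_max; apply/orP; left.
by rewrite (big_rem x)//= leq_max leqnn.
Qed.

Lemma energy_finite_support xi :
  finite_set [set A : {fset site d} | (A `&` L)%fset != fset0 /\ Phi A xi != 0].
Proof.
have [N HN] := interaction_neighborhood.
apply: (@sub_finite_set _ _ [set` fpowerset N]); last exact: finite_fset.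
move=> A /= [AL]; rewrite fpowersetE.
by case: (HN A AL) => // ->; rewrite eqxx.
Qed.

Lemma energy_local : exists N : {fset site d},
  forall xi xi' : config d (E * E')%type,
    (forall x, x \in N -> xi x = xi' x) -> energy xi = energy xi'.
Proof.
have [N HN] := interaction_neighborhood.
exists N => xi xi' eqN; apply: eq_fsbigr => A; rewrite inE /= => AL.
case: (HN A AL) => [/fsubsetP AN|Phi0]; last by rewrite !Phi0.
by apply: pot_local => x /AN; exact: eqN.
Qed.

Lemma partition_function_gt0 eta : 0 < partition_function eta.
Proof.
rewrite /partition_function (bigD1 [ffun=> point])//=.
by rewrite ltr_pwDl ?expR_gt0// sumr_ge0// => s _; exact: expR_ge0.
Qed.

Lemma gibbs_ge0 eta B : 0 <= gibbs eta B.
Proof.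
rewrite mulr_ge0 ?invr_ge0 ?(ltW (partition_function_gt0 _))//.
by rewrite sumr_ge0// => s _; rewrite mulr_ge0// expR_ge0.
Qed.

Lemma gibbsT eta : gibbs eta setT = 1.
Proof.
rewrite /gibbs; under eq_bigr do rewrite indicT mul1r.
by rewrite mulVf// gt_eqF// partition_function_gt0.
Qed.

Lemma gibbs_dirac eta B : (gibbs eta B)%:E =
  (\sum_(s : {ffun L -> E}) ((partition_function eta)^-1 * boltzmann eta s)%:E *
     \d_(glue s bc) B)%E.
Proof.
rewrite /gibbs mulr_sumr -sumEFin; apply: eq_bigr => s _.
by rewrite diracE -EFinM mulrCA mulrC indicE.
Qed.

Lemma measurable_gibbs (B : set (config d (E * E')%type)) : measurable B ->
  measurable_fun setT
    (fun eta : config d E' => (gibbs eta [set sigma | B (joint sigma eta)])%:E).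
Proof.
move=> mB; apply/measurable_EFinP.
have [N HN] := energy_local.
have bN (eta eta' : config d E') s :
    (forall x, x \in N -> eta x = eta' x) -> boltzmann eta s = boltzmann eta' s.
  move=> eqN; rewrite /boltzmann; congr (expR (- _)); apply: HN => x xN.
  by rewrite /joint eqN.
apply: measurable_funM.
  apply: (measurable_local (L := N)) => eta eta' eqN; congr (_^-1).
  by apply: eq_bigr => s _; exact: bN.
apply: measurable_sum => s; apply: measurable_funM; last first.
  by apply: (measurable_local (L := N)) => eta eta' eqN; exact: bN.
rewrite (_ : (fun _ => _) =
  \1_[set eta | B (joint (glue s bc) eta)]); last first.
  by apply/funext => eta; rewrite !indicE; congr (_%:R); apply/idP/idP; rewrite !inE.
apply: measurable_indic.
by have := measurable_jointr (glue s bc) measurableT mB; rewrite setTI.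
Qed.

End FiniteVolume.

Section QuenchedJointMeasure.
Local Open Scope ereal_scope.
Variables (P : probability (config d E') R) (Phi : finite_range_potential).
Variables (L : {fset site d}) (bc : config d E).

(* P(d eta) mu_L^bc[eta](d sigma) *)
Definition quenched_joint (B : set (config d (E * E')%type)) : \bar R :=
  \int[P]_eta (gibbs Phi L bc eta [set sigma | B (joint sigma eta)])%:E.

Let quenched_joint0 : quenched_joint set0 = 0.
Proof.
rewrite /quenched_joint integral0_eq// => eta _.
by rewrite gibbs_dirac big1// => s _; rewrite dirac0 mule0.
Qed.

Let quenched_joint_ge0 B : 0 <= quenched_joint B.
Proof. by apply: integral_ge0 => eta _; rewrite lee_fin gibbs_ge0. Qed.

Let gibbs_coef_ge0 eta (s : {ffun L -> E}) :
  (0 <= (partition_function Phi L bc eta)^-1 * @boltzmann Phi L bc eta s)%R.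
Proof.
by rewrite mulr_ge0 ?expR_ge0// invr_ge0 ltW// partition_function_gt0.
Qed.

Let quenched_joint_sigma_additive : semi_sigma_additive quenched_joint.
Proof.
move=> F mF tF mUF.
have -> : quenched_joint (\bigcup_n F n) = \sum_(n <oo) quenched_joint (F n).
  rewrite /quenched_joint -integral_nneseries//; last 2 first.
  - by move=> n; exact: measurable_gibbs.
  - by move=> n eta _; rewrite lee_fin gibbs_ge0.
  apply: eq_integral => eta _.
  under eq_eseriesr do rewrite gibbs_dirac.
  rewrite nneseries_sum; last first.
    by move=> s n _; rewrite mule_ge0// lee_fin ?gibbs_coef_ge0.
  rewrite gibbs_dirac; apply: eq_bigr => s _.
  rewrite nneseriesZl//; congr (_ * _).
  set G := fun n => [set sigma | F n (joint sigma eta)].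
  rewrite (_ : [set _ | _] = \bigcup_n G n); last first.
    by apply/seteqP; split=> sigma [n _ ?]; exists n.
  have tG : trivIset setT G.
    apply/trivIsetP => i j _ _ ij; apply/seteqP; split => // sigma [Fi Fj].
    by have /trivIsetP/(_ i j Logic.I Logic.I ij)/seteqP[/(_ _ (conj Fi Fj))] := tF.
  have mG n : measurable (G n).
    by have := measurable_jointl eta measurableT (mF n); rewrite setTI.
  by rewrite measure_semi_bigcup//; exact: bigcup_measurable.
apply: is_cvg_nneseries => n _ _; exact: quenched_joint_ge0.
Qed.

HB.instance Definition _ := isMeasure.Build _ _ _ quenched_joint
  quenched_joint0 quenched_joint_ge0 quenched_joint_sigma_additive.

Let quenched_jointT : quenched_joint setT = 1.
Proof.
rewrite /quenched_joint; under eq_integral do rewrite gibbsT.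
by rewrite integral_cst// mul1e; exact: probability_setT.
Qed.

HB.instance Definition _ :=
  Measure_isProbability.Build _ _ _ quenched_joint quenched_jointT.

End QuenchedJointMeasure.

Definition weak_cvg (K_ : nat -> {measure set (config d (E * E')%type) -> \bar R})
    (K : {measure set (config d (E * E')%type) -> \bar R}) : Prop :=
  forall f : config d (E * E')%type -> R,
    continuous f -> (exists M : R, forall xi, `|f xi| <= M) ->
    (fun N => \int[K_ N]_xi (f xi)%:E)%E @ \oo --> (\int[K]_xi (f xi)%:E)%E.

Definition joint_measure (P : probability (config d E') R)
    (Phi : finite_range_potential) (bc : config d E)
    (K : probability (config d (E * E')%type) R) : Prop :=
  exists L : nat -> {fset site d},
    [/\ forall N, (L N `<=` L N.+1)%fset,
        forall x : site d, exists N, x \in L N &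
        weak_cvg (fun N => quenched_joint P Phi (L N) bc) K].

End QuenchedSystem.

Section Invariance.
Variables (R : realType) (d : nat) (S : pfinType).
Implicit Types P K : probability (config d S) R.

Definition translation_invariant P : Prop :=
  forall (z : site d) (B : set (config d S)),
    measurable B -> P (shift z @^-1` B) = P B.

Definition asymptotically_decoupled P : Prop :=
  translation_invariant P /\
  exists (g : nat -> nat) (c : nat -> R),
    [/\ (fun n => c n / (#|` box d n|)%:R) @ \oo --> (0 : R),
        (fun n => (g n)%:R / n%:R : R) @ \oo --> (0 : R) &
        forall (n : nat) (A B : set (config d S)),
          sigma_field [set` box d n] A ->
          sigma_field (~` [set` box d (n + g n)]) B ->
          (P A * P B != 0)%E ->
          expR (- c n) <= fine (P (A `&` B)) / (fine (P A) * fine (P B))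
            <= expR (c n)].

Definition marginal_dominated (L : {fset site d}) K K' : Prop :=
  forall A : set (config d S), sigma_field [set` L] A -> K' A = 0%E -> K A = 0%E.

(* As [ln 0 = 0], terms with K(xi_L) = 0 vanish; under the domination
   hypothesis no other term has K'(xi_L) = 0. *)
Definition relative_entropy (L : {fset site d}) K K' : \bar R :=
  if `[< marginal_dominated L K K' >] then
    (\sum_(s : {ffun L -> S}) fine (K (cylinder s)) *
       ln (fine (K (cylinder s)) / fine (K' (cylinder s))))%:E
  else +oo%E.

Definition has_relative_entropy_density K K' (h : \bar R) : Prop :=
  (fun n => ((#|` box d n|)%:R^-1)%:E * relative_entropy (box d n) K K')%E
    @ \oo --> h.

End Invariance.

(* Main.v *)
From Pilot Require Import Defs.
From mathcomp Require Import all_boot all_order all_algebra finmap zify ring lra.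
From mathcomp Require Import all_classical all_reals all_analysis.
From mathcomp Require Import measurable_realfun.
Import Pilot.Defs.

(** The idea is that the joint measure K' inherits an upper decoupling bound
    from the disorder, and that such a bound makes finite-volume relative
    entropies almost superadditive.

    Entropy. Suppose that K'(A and B) <= exp(c_n) K'(A) K'(B) for cylinders A in
    the box of radius n and B off the box of radius l_n, with c_n = o(|box n|) and
    l_n / n -> 1. Then the relative entropy of two such volumes is at least the sum of
    their relative entropies minus c_n ([entropy_super]); it is also monotone in
    the volume ([entropy_mono]) and translation invariant. Packing translates of
    box n into box m ([packing]) bounds the lower limit of the densities below by
    (h_n - c_n) / |box l_n|, where h_n is the relative entropy in box n. As
    |box l_n| / |box n| -> 1, the densities converge to the supremum of these
    bounds ([cvg_self_improving]). If K is not dominated by K' on some box, the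
    same holds on all larger ones, and the limit is infinite.

    Decoupling. In a large finite volume the spins in a shell around box n are
    frozen, at a bounded cost per site. Given the disorder, the Gibbs measure with
    a frozen shell is a product ([frozen_gibbs]) whose two factors depend on
    the disorder near box n and outside the shell respectively. If
    the shell is somewhat wider than the gap required by the disorder, the integral
    over the disorder splits as well ([quenched_decoupled]). The shell has o(|box n|)
    sites, and the bound passes to the weak limit ([joint_decoupled_box]).

    Uniform cost. The cost of changing one spin must be bounded uniformly in its
    position, although the potential is not assumed to be translation invariant or
    bounded. The bound comes from the invariance of the limit K': the weight ratio
    of two configurations differing at x is a quotient of K'-probabilities of patterns
    on a translate of a fixed box ([spin_ratio]), and these probabilities range
    over a finite set ([uniform_spin_ratio]). *)

Set Implicit Arguments.
Unset Strict Implicit.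
Unset Printing Implicit Defensive.

Import Order.TTheory GRing.Theory Num.Theory.
Import numFieldNormedType.Exports.

Local Open Scope classical_set_scope.
Local Open Scope ring_scope.

Local Notation site d := 'rV[int]_d.

(** * Finite spin sums over configurations *)

Section SpinSum.
Variables (R : realType) (d : nat) (S : pfinType).
Implicit Types (L D M : {fset site d}) (xi t : config d S) (f g : config d S -> R).

Definition agree L xi : set (config d S) :=
  [set xi' | forall x, x \in L -> xi' x = xi x].

Definition depends_on (T : Type) L (f : config d S -> T) : Prop :=
  forall xi xi' : config d S,
    (forall x, x \in L -> xi x = xi' x) -> f xi = f xi'.

Definition overwrite L t xi : config d S :=
  fun x => if x \in L then t x else xi x.

(** Partition functions, marginals and expectations are all of this form. Summing
    a function of the whole configuration, with [xi] as boundary condition,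
    makes successive sums compose without any dependent types. *)
Definition spin_sum L g xi : R := \sum_(s : {ffun L -> S}) g (glue s xi).

Lemma overwrite_in L t xi x : x \in L -> overwrite L t xi x = t x.
Proof. by rewrite /overwrite => ->. Qed.

Lemma overwrite_out L t xi x : x \notin L -> overwrite L t xi x = xi x.
Proof. by rewrite /overwrite => /negbTE ->. Qed.

Lemma glueE L (s : {ffun L -> S}) xi xi' : glue s xi = overwrite L (glue s xi') xi.
Proof.
by apply/funext => x; rewrite /overwrite /glue; case: insubP => [u -> _//|/negbTE ->].
Qed.

Lemma glue_out L (s : {ffun L -> S}) xi x : x \notin L -> glue s xi x = xi x.
Proof. by move=> xL; rewrite (glueE s xi xi) overwrite_out. Qed.

Lemma glue_in L (s : {ffun L -> S}) xi (x : L) : glue s xi (val x) = s x.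
Proof. by rewrite /glue valK. Qed.

Definition pattern L xi : {ffun L -> S} := [ffun x => xi (val x)].

Lemma glue_pattern L t xi : glue (pattern L t) xi = overwrite L t xi.
Proof.
apply/funext => x; rewrite /overwrite /glue.
by case: insubP => [u -> <-|/negbTE ->//]; rewrite ffunE.
Qed.

Lemma cylinder_agree L (s : {ffun L -> S}) xi : cylinder s = agree L (glue s xi).
Proof.
apply/seteqP; split => [z sz x xL|z sz x].
  by rewrite -[x]/(val [` xL]%fset) glue_in; exact: sz.
by rewrite sz ?fsvalP// glue_in.
Qed.

Lemma agree_cylinder L xi : agree L xi = cylinder (pattern L xi).
Proof.
rewrite (cylinder_agree _ xi) glue_pattern; congr agree.
by apply/funext => x; rewrite /overwrite if_same.
Qed.

Lemma measurable_agree L xi : measurable (agree L xi).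
Proof. by rewrite agree_cylinder; exact: measurable_cylinder. Qed.

Lemma agree_sub L M xi : (M `<=` L)%fset -> agree L xi `<=` agree M xi.
Proof. by move=> /fsubsetP ML z zx x /ML; exact: zx. Qed.

Lemma agreeU L M xi : agree (L `|` M)%fset xi = agree L xi `&` agree M xi.
Proof.
apply/seteqP; split=> [z zx|z [zL zM] x].
  by split; apply: agree_sub zx; [exact: fsubsetUl|exact: fsubsetUr].
by rewrite inE => /orP[/zL|/zM].
Qed.

Lemma agree_eq L xi xi' : (forall x, x \in L -> xi x = xi' x) ->
  agree L xi = agree L xi'.
Proof.
by move=> e; apply/seteqP; split => z zx x xL; rewrite (zx x xL) e.
Qed.

Lemma depends_onS (T : Type) L M (f : config d S -> T) :
  (L `<=` M)%fset -> depends_on L f -> depends_on M f.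
Proof. by move=> /fsubsetP LM fL xi xi' e; apply: fL => x /LM; exact: e. Qed.

Lemma depends_on_indic L M xi : (L `<=` M)%fset ->
  depends_on M (\1_(agree L xi) : config d S -> R).
Proof.
move=> /fsubsetP LM z z' e; rewrite !indicE; congr (_%:R).
congr (nat_of_bool _); apply/idP/idP; rewrite !inE => h x xL.
  by rewrite -e ?h// LM.
by rewrite e ?h// LM.
Qed.

Lemma eq_spin_sum L g g' xi :
  (forall z, (forall x, x \notin L -> z x = xi x) -> g z = g' z) ->
  spin_sum L g xi = spin_sum L g' xi.
Proof. by move=> e; apply: eq_bigr => s _; apply: e => x; exact: glue_out. Qed.

Lemma le_spin_sum L g g' xi :
  (forall z, (forall x, x \notin L -> z x = xi x) -> g z <= g' z) ->
  spin_sum L g xi <= spin_sum L g' xi.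
Proof. by move=> e; apply: ler_sum => s _; apply: e => x; exact: glue_out. Qed.

Lemma spin_sum_ge0 L g xi : (forall z, 0 <= g z) -> 0 <= spin_sum L g xi.
Proof. by move=> g0; rewrite /spin_sum sumr_ge0. Qed.

Lemma spin_sum_gt0 L g xi : (forall z, 0 < g z) -> 0 < spin_sum L g xi.
Proof.
move=> g0; rewrite /spin_sum (bigD1 [ffun=> point])//= ltr_pwDl//.
by rewrite sumr_ge0// => s _; exact: ltW.
Qed.

Lemma spin_sumD L g g' xi :
  spin_sum L (fun z => g z + g' z) xi = spin_sum L g xi + spin_sum L g' xi.
Proof. exact: big_split. Qed.

Lemma spin_sumZ L c g xi :
  spin_sum L (fun z => c * g z) xi = c * spin_sum L g xi.
Proof. by rewrite /spin_sum mulr_sumr. Qed.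

Lemma spin_sumZr L c g xi :
  spin_sum L (fun z => g z * c) xi = spin_sum L g xi * c.
Proof. by rewrite /spin_sum mulr_suml. Qed.

Lemma spin_sum_factor L f g xi :
  (forall z, (forall x, x \notin L -> z x = xi x) -> f z = f xi) ->
  spin_sum L (fun z => f z * g z) xi = f xi * spin_sum L g xi.
Proof.
by move=> h; rewrite -spin_sumZ; apply: eq_spin_sum => z zxi; rewrite h.
Qed.

Lemma spin_sum0 g xi : spin_sum fset0 g xi = g xi.
Proof.
have e (s : {ffun (fset0 : {fset site d}) -> S}) : s = pattern fset0 xi.
  by apply/ffunP => -[x xL]; exfalso; rewrite inE in xL.
rewrite /spin_sum (bigD1 (pattern fset0 xi))//= big1 ?addr0.
  by congr g; rewrite glue_pattern; apply/funext => x; rewrite overwrite_out// inE.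
by move=> s; rewrite (e s) eqxx.
Qed.

(** Fubini for spin sums; every factorisation below comes from it. *)
Lemma spin_sumU L M g xi : [disjoint L & M]%fset ->
  spin_sum (L `|` M)%fset g xi = spin_sum L (spin_sum M g) xi.
Proof.
move=> dLM; rewrite /spin_sum pair_big /=.
rewrite (reindex (fun p : {ffun L -> S} * {ffun M -> S} =>
  pattern (L `|` M)%fset (glue p.2 (glue p.1 xi)))) /=; last first.
  exists (fun s => (pattern L (glue s xi), pattern M (glue s xi))).
    move=> [s1 s2] _ /=; rewrite glue_pattern; congr (_, _); apply/ffunP => x.
      rewrite !ffunE overwrite_in; last by rewrite inE fsvalP.
      rewrite glue_out ?glue_in//.
      by apply/negP => xM; move/fdisjointP : dLM => /(_ _ (fsvalP x)); rewrite xM.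
    by rewrite !ffunE overwrite_in ?glue_in// inE fsvalP orbT.
  move=> s _ /=; apply/ffunP => x; rewrite ffunE.
  rewrite !glue_pattern /overwrite; case: ifPn => [xM|xM]; first by rewrite glue_in.
  case: ifPn => xL; first by rewrite glue_in.
  by have := fsvalP x; rewrite inE (negbTE xM) (negbTE xL).
apply: eq_bigr => -[s1 s2] _ /=; rewrite glue_pattern; congr g.
apply/funext => x; rewrite /overwrite; case: ifPn => //.
by rewrite inE negb_or => /andP[xL xM]; rewrite !glue_out.
Qed.

Lemma spin_sum_cst L c xi : spin_sum L (fun=> c) xi = c *+ #|{ffun L -> S}|.
Proof. by rewrite /spin_sum sumr_const. Qed.

Lemma ge_spin_sum_term L g t xi : (forall z, 0 <= g z) ->
  g (overwrite L t xi) <= spin_sum L g xi.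
Proof.
move=> g0; rewrite /spin_sum (bigD1 (pattern L t))//= glue_pattern.
by rewrite lerDl sumr_ge0.
Qed.

Lemma spin_sum_indic L g t xi :
  spin_sum L (fun z => \1_(agree L t) z * g z) xi = g (overwrite L t xi).
Proof.
rewrite /spin_sum (bigD1 (pattern L t))//= big1 ?addr0.
  rewrite glue_pattern indicE mem_set ?mul1r// => x xL.
  by rewrite overwrite_in.
move=> s st; rewrite indicE memNset ?mul0r// => h; move/eqP: st; apply.
by apply/ffunP => x; rewrite ffunE -h ?fsvalP// glue_in.
Qed.

Lemma spin_sum_prod L M A B f g xi :
  [disjoint L & M]%fset -> [disjoint A & M]%fset -> [disjoint B & L]%fset ->
  depends_on A f -> depends_on B g ->
  spin_sum (L `|` M)%fset (fun z => f z * g z) xi =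
  spin_sum L f xi * spin_sum M g xi.
Proof.
move=> dLM /fdisjointP dAM /fdisjointP dBL fA gB; rewrite spin_sumU//.
rewrite (@eq_spin_sum _ _ (fun z => f z * spin_sum M g xi)) ?spin_sumZr// => z e.
rewrite spin_sum_factor => [|z' e'].
  congr (_ * _); apply: eq_bigr => s _; apply: gB => x xB.
  by rewrite /glue; case: insub => //; rewrite e// dBL.
by apply: fA => x xA; rewrite e'// dAM.
Qed.

Lemma overwrite_comm L M t s xi : [disjoint L & M]%fset ->
  overwrite L t (overwrite M s xi) = overwrite M s (overwrite L t xi).
Proof.
move=> /fdisjointP dLM; apply/funext => x; rewrite /overwrite.
by case: (boolP (x \in L)) => [/dLM/negbTE ->|].
Qed.

Lemma overwriteU L M t xi :
  overwrite (L `|` M)%fset t xi = overwrite L t (overwrite M t xi).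
Proof. by apply/funext => x; rewrite /overwrite inE; case: (x \in L). Qed.

Lemma overwrite_eq L t xi xi' : (forall x, x \notin L -> xi x = xi' x) ->
  overwrite L t xi = overwrite L t xi'.
Proof. by move=> e; apply/funext => x; rewrite /overwrite; case: ifPn => // /e. Qed.

Lemma card_pattern L : #|{ffun L -> S}| = (#|S| ^ #|` L|)%N.
Proof. by rewrite card_ffun cardfE. Qed.

(** Replacing the spins of [D] by those of [t] costs the factor [C], and the
    [#|S| ^ #|` D|] patterns on [D] then all give the same summand. *)
Lemma spin_sum_freeze_le D M g t C xi : [disjoint D & M]%fset ->
  (forall z, g z <= C * g (overwrite D t z)) ->
  spin_sum (D `|` M)%fset g xi <=
    (#|S| ^ #|` D|)%:R * C * spin_sum M g (overwrite D t xi).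
Proof.
move=> dDM gC; rewrite spin_sumU// -card_pattern.
apply: (@le_trans _ _ (spin_sum D (fun=> C * spin_sum M g (overwrite D t xi)) xi)).
  apply: le_spin_sum => z e; rewrite /spin_sum mulr_sumr; apply: ler_sum => s _.
  apply: le_trans (gC _) _; rewrite (glueE s z xi) (glueE s (overwrite D t xi) xi).
  by rewrite overwrite_comm// (overwrite_eq t e).
by rewrite spin_sum_cst -mulrA mulr_natl.
Qed.

(** The frozen sum is one of the terms of the sum over patterns on [D]. *)
Lemma spin_sum_freeze_ge D M g t xi : [disjoint D & M]%fset ->
  (forall z, 0 <= g z) ->
  spin_sum M g (overwrite D t xi) <= spin_sum (D `|` M)%fset g xi.
Proof.
move=> dDM g0; rewrite spin_sumU//.
by apply: (@ge_spin_sum_term D (spin_sum M g)) => z; exact: spin_sum_ge0.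
Qed.

(** A bound on the cost of changing one spin gives a bound for [D] by changing
    its spins one at a time. *)
Lemma overwrite_bound D g t C xi : 0 <= C ->
  (forall x z, x \in D -> g z <= C * g (overwrite [fset x]%fset t z)) ->
  g xi <= C ^+ #|` D| * g (overwrite D t xi).
Proof.
move=> C0; elim/finSet_rect: D => D IH gC.
have [->|[x xD]] := fset_0Vmem D.
  by rewrite cardfs0 expr0 mul1r.
rewrite (cardfsD1 x) xD add1n exprSr -mulrA -{2}(fsetD1K xD) overwriteU.
apply: le_trans (IH _ (fproperD1 xD) _) _.
  by move=> y z; rewrite inE => /andP[_]; exact: gC.
by rewrite ler_wpM2l ?exprn_ge0// gC.
Qed.

Lemma depends_on_bounded L f : depends_on L f -> exists2 C, 0 < C & forall z, `|f z| <= C.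
Proof.
move=> fL.
exists (\sum_(s : {ffun L -> S}) `|f (glue s point)| + 1) => [|z].
  by rewrite ltr_wpDl// sumr_ge0.
rewrite (bigD1 (pattern L z))//= glue_pattern.
have -> : f (overwrite L z point) = f z by apply: fL => x xL; rewrite overwrite_in.
by rewrite -addrA lerDl addr_ge0// sumr_ge0.
Qed.

(** A local function takes finitely many values, so its positive values are
    bounded away from zero. *)
Lemma depends_on_min L f : depends_on L f ->
  exists2 C, 0 < C & forall z, 0 < f z -> C <= f z.
Proof.
move=> fL; have [C C0 CP] := @depends_on_bounded L (fun z => (f z)^-1)
  (fun z z' e => congr1 _ (fL z z' e)).
exists C^-1 => [|z fz]; first by rewrite invr_gt0.
by rewrite -[leRHS]invrK lef_pV2 ?posrE ?invr_gt0// (le_trans _ (CP z))// ler_norm.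
Qed.

End SpinSum.

(** * Cylinder probabilities and decoupling *)

Section LocalProbability.
Variables (R : realType) (d : nat) (S : pfinType).
Implicit Types (L M : {fset site d}) (xi : config d S).

Section Measure.
Variable P : probability (config d S) R.

Definition pr L xi : R := fine (P (agree L xi)).

Lemma prE L xi : P (agree L xi) = (pr L xi)%:E.
Proof. by rewrite fineK// fin_num_measure//; exact: measurable_agree. Qed.

Lemma pr_ge0 L xi : 0 <= pr L xi.
Proof. exact: fine_ge0. Qed.

Lemma pr_le1 L xi : pr L xi <= 1.
Proof. by rewrite -lee_fin -prE probability_le1//; exact: measurable_agree. Qed.

Lemma depends_on_pr L : depends_on L (pr L).
Proof. by move=> z z' e; rewrite /pr (agree_eq e). Qed.

Lemma pr_sub L M xi : (M `<=` L)%fset -> pr L xi <= pr M xi.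
Proof.
move=> ML; rewrite -lee_fin -!prE le_measure ?inE//; try exact: measurable_agree.
exact: agree_sub.
Qed.

Lemma pr_fset0 xi : pr fset0 xi = 1.
Proof.
rewrite /pr (_ : agree _ _ = setT) ?probability_setT//.
by apply/seteqP; split => // z _ x; rewrite inE.
Qed.

(** Consistency of the finite-dimensional distributions. *)
Lemma pr_marginal L M xi : [disjoint L & M]%fset ->
  spin_sum M (pr (L `|` M)%fset) xi = pr L xi.
Proof.
move=> dLM; apply/EFin_inj; rewrite -prE /spin_sum -sumEFin.
under eq_bigr do rewrite -prE.
rewrite (_ : agree L xi =
    \bigcup_(s in [set: {ffun M -> S}]) agree (L `|` M)%fset (glue s xi)).
  rewrite measure_fin_bigcup//=; last 2 first.
  - apply/trivIsetP => s s' _ _; apply: contraNeq => /set0P[z [zs zs']].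
    apply/eqP/ffunP => x; rewrite -(glue_in s xi) -(glue_in s' xi).
    by rewrite -zs ?inE ?fsvalP ?orbT// -zs' ?inE ?fsvalP ?orbT.
  - by move=> s _; exact: measurable_agree.
  rewrite (fsbigE (enum {: {ffun M -> S}})) ?enum_uniq//; last first.
    by move=> s _; rewrite mem_enum.
  by rewrite big_enum_cond/=; apply: eq_bigl => s; rewrite in_setT.
have gL s x : x \in L -> glue (s : {ffun M -> S}) xi x = xi x.
  by move=> xL; rewrite glue_out//; move/fdisjointP : dLM; exact.
apply/seteqP; split => [z zx|z [s _ zs] x xL]; last first.
  by rewrite zs ?inE ?xL// gL.
exists (pattern M z) => // x; rewrite inE; case: (boolP (x \in L)) => /= xL.
  by rewrite gL// zx.
by move=> xM; rewrite glue_pattern overwrite_in.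
Qed.

Lemma pr_total L xi : spin_sum L (pr L) xi = 1.
Proof.
have := @pr_marginal fset0 L xi; rewrite fset0U pr_fset0; apply.
exact: fdisjoint0X.
Qed.

Lemma local_sum_indic L (f : config d S -> R) xi : depends_on L f ->
  forall z, f z = \sum_(s : {ffun L -> S}) f (glue s xi) * \1_(agree L (glue s xi)) z.
Proof.
move=> fL z; rewrite (bigD1 (pattern L z))//= glue_pattern big1 ?addr0.
  rewrite indicE mem_set ?mulr1; first by apply: fL => x xL; rewrite overwrite_in.
  by move=> x xL; rewrite overwrite_in.
move=> s sz; rewrite indicE memNset ?mulr0// => h; move/eqP: sz; apply.
by apply/ffunP => x; rewrite ffunE h ?fsvalP// glue_in.
Qed.

(** The integrals over the disorder are all of local functions, hence finite sums
    in which null patterns carry no weight; almost sure statements about the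
    disorder thus become statements about patterns of positive probability. *)
Lemma integral_local L (f : config d S -> R) xi :
  depends_on L f -> (forall z, 0 <= f z) ->
  (\int[P]_z (f z)%:E = (spin_sum L (fun z => pr L z * f z) xi)%:E)%E.
Proof.
move=> fL f0.
under eq_integral do rewrite (local_sum_indic xi fL) -sumEFin.
rewrite ge0_integral_sum//; last 2 first.
- move=> s; apply/measurable_EFinP; apply: measurable_funM => //.
  by apply: measurable_indic; exact: measurable_agree.
- by move=> s z _; rewrite lee_fin mulr_ge0.
rewrite /spin_sum -sumEFin; apply: eq_bigr => s _.
under eq_integral do rewrite EFinM.
rewrite ge0_integralZl//=; last 2 first.
- apply/measurable_EFinP; apply: measurable_indic; exact: measurable_agree.
- by rewrite lee_fin.
rewrite integral_indic ?setIT//; last exact: measurable_agree.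
by rewrite mulrC EFinM; congr (_ * _)%E; exact: prE.
Qed.

End Measure.

Definition translate (z : site d) L : {fset site d} := [fset (x + z)%R | x in L]%fset.

Lemma mem_translate z L x : (x \in translate z L) = (x - z \in L).
Proof.
apply/imfsetP/idP => [[y yL ->]|xL]; first by rewrite addrK.
by exists (x - z) => //; rewrite subrK.
Qed.

Lemma pr_translate (P : probability (config d S) R) z L xi :
  translation_invariant P -> pr P (translate z L) xi = pr P L (shift z xi).
Proof.
move=> Pinv; rewrite /pr -[in RHS](Pinv z); last exact: measurable_agree.
congr (fine (P _)); apply/seteqP; split => z' /= h x xL.
  by rewrite /shift h// mem_translate addrK.
by have := h (x - z); rewrite /shift subrK -mem_translate; exact.
Qed.

Lemma sigma_field_agree (X : set (site d)) L xi :
  (forall x, x \in L -> X x) -> sigma_field X (agree L xi).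
Proof.
move=> LX; rewrite (_ : agree L xi = 
   \bigcap_(x in [set` L]) [set z : config d S | z x = xi x]); last first.
  by apply/seteqP; split.
have : forall x, [set` L] x -> sigma_field X [set z : config d S | z x = xi x].
  by move=> x /= xL; apply: sub_sigma_algebra; exists x, (xi x); split => //; exact: LX.
exact: (@fin_bigcap_measurable _ (g_sigma_algebraType (@coord_events d S X))).
Qed.

(** Written as a product, the bound also holds when one of the events is null. *)
Lemma decoupled_pr (P : probability (config d S) R) (n k : nat) (c : R) :
  (forall (A B : set (config d S)),
    sigma_field [set` box d n] A -> sigma_field (~` [set` box d k]) B ->
    (P A * P B != 0)%E ->
    expR (- c) <= fine (P (A `&` B)) / (fine (P A) * fine (P B)) <= expR c) ->
  forall L M xi, (L `<=` box d n)%fset -> [disjoint M & box d k]%fset ->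
    pr P (L `|` M)%fset xi <= expR c * (pr P L xi * pr P M xi).
Proof.
move=> dec L M xi /fsubsetP Ln /fdisjointP Mk.
have [z|nz] := eqVneq (pr P L xi * pr P M xi) 0.
  rewrite z mulr0; move/eqP: z; rewrite mulf_eq0 => /orP[]/eqP <-.
    by apply: pr_sub; exact: fsubsetUl.
  by apply: pr_sub; exact: fsubsetUr.
have : (P (agree L xi) * P (agree M xi) != 0)%E.
  by rewrite !prE -EFinM eqe.
move/dec => /(_ _ _)/andP[|| _].
- by apply: sigma_field_agree => x /Ln.
- by apply: sigma_field_agree => x /Mk /= h; apply/negP.
rewrite -agreeU ler_pdivrMr//.
by rewrite lt_neqAle eq_sym nz/= mulr_ge0// pr_ge0.
Qed.

(** For local [f] and large enough [L], this is the integral of [f] under [P]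
    ([integral_local]); the value no longer depends on [L] ([expect_indep]). *)
Definition expect (P : probability (config d S) R) L (f : config d S -> R) : R :=
  spin_sum L (fun z => pr P L z * f z) point.

Lemma depends_onM L (f g : config d S -> R) :
  depends_on L f -> depends_on L g -> depends_on L (fun z => f z * g z).
Proof. by move=> fL gL z z' e; rewrite (fL _ _ e) (gL _ _ e). Qed.

Lemma expect_indep (P : probability (config d S) R) W L (f : config d S -> R) :
  (L `<=` W)%fset -> depends_on L f -> expect P W f = expect P L f.
Proof.
move=> LW fL; rewrite /expect; have -> : W = (L `|` (W `\` L))%fset.
  by apply/fsetP => x; rewrite !inE; case: (boolP (x \in L)) => //= /(fsubsetP LW).
have dL : [disjoint L & W `\` L]%fset.
  by apply/fdisjointP => x xL; rewrite !inE xL.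
rewrite spin_sumU//; apply: eq_spin_sum => z _.
under eq_spin_sum do rewrite mulrC.
rewrite spin_sum_factor ?pr_marginal// 1?mulrC// => z' e; apply: fL => x xL.
by rewrite e//; move/fdisjointP: dL; exact.
Qed.

(** Local observables are combinations of cylinder events, so they inherit the
    bound known for cylinders. *)
Lemma decoupled_expect (P : probability (config d S) R) W L M C (f g : config d S -> R) :
  (L `<=` W)%fset -> (M `<=` W)%fset -> [disjoint L & M]%fset ->
  (forall z, 0 <= f z) -> (forall z, 0 <= g z) ->
  depends_on L f -> depends_on M g ->
  (forall z, pr P (L `|` M)%fset z <= C * (pr P L z * pr P M z)) ->
  expect P W (fun z => f z * g z) <= C * (expect P W f * expect P W g).
Proof.
move=> LW MW dLM f0 g0 fL gM PC.
rewrite (expect_indep P LW fL) (expect_indep P MW gM).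
rewrite (@expect_indep P _ (L `|` M)%fset); last 2 first.
- by rewrite fsubUset LW.
- apply: depends_onM; first by apply: depends_onS fL; exact: fsubsetUl.
  by apply: depends_onS gM; exact: fsubsetUr.
rewrite /expect; apply: (@le_trans _ _ (spin_sum (L `|` M)%fset
   (fun z => C * ((pr P L z * f z) * (pr P M z * g z))) point)).
  apply: le_spin_sum => z _; rewrite (mulrACA (pr P L z)) [leRHS]mulrA.
  by rewrite ler_wpM2r// mulr_ge0.
rewrite spin_sumZ (@spin_sum_prod _ _ _ _ _ L M)//.
- by rewrite fdisjoint_sym.
- by apply: depends_onM => //; exact: depends_on_pr.
- by apply: depends_onM => //; exact: depends_on_pr.
Qed.

End LocalProbability.

(** * Boxes and energies *)

Section Boxes.
Variable d : nat.
Implicit Types (L M : {fset site d}) (x y z : site d).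

Lemma in_boxP n x : reflect (forall i, (`|x 0%R i| <= n)%N) (x \in box d n).
Proof. by rewrite in_box; exact: forallP. Qed.

Lemma box_subset n m : (n <= m)%N -> (box d n `<=` box d m)%fset.
Proof.
move=> nm; apply/fsubsetP => x /in_boxP h; apply/in_boxP => i.
exact: leq_trans nm.
Qed.

Lemma box_addr n m x y : x \in box d n -> y \in box d m -> x + y \in box d (n + m).
Proof.
move=> /in_boxP xn /in_boxP ym; apply/in_boxP => i.
by rewrite mxE; have := xn i; have := ym i; move: (x 0 i) (y 0 i) => u v; lia.
Qed.

Lemma box_opp n x : (- x \in box d n) = (x \in box d n).
Proof. by apply/in_boxP/in_boxP => h i; have := h i; rewrite mxE abszN. Qed.

Lemma box0 n : 0 \in box d n.
Proof. by apply/in_boxP => i; rewrite mxE. Qed.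

Lemma card_box n : #|` box d n| = ((n + n).+1 ^ d)%N.
Proof.
rewrite /box card_imfset/=; first by rewrite -cardE card_ffun !card_ord.
move=> f g /rowP e; apply/ffunP => i; apply/val_inj.
by have := e i; rewrite !mxE => /addIr [].
Qed.

(** Sets that meet [L] and have diameter at most [r] lie in this neighbourhood. *)
Definition nbhd (r : nat) L : {fset site d} :=
  [fset (x + y)%R | x in L, y in box d r]%fset.

Lemma mem_nbhd r L x y : y \in L -> x - y \in box d r -> x \in nbhd r L.
Proof.
move=> yL xy; apply/imfset2P; exists y => //; exists (x - y) => //.
by rewrite addrC subrK.
Qed.

Lemma nbhdP r L x : reflect (exists2 y, y \in L & x - y \in box d r) (x \in nbhd r L).
Proof.
apply: (iffP idP) => [|[y yL xy]]; last exact: mem_nbhd xy.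
by move=> /imfset2P[y yL [z zr ->]]; exists y => //; rewrite addrAC subrr add0r.
Qed.

Lemma subset_nbhd r L : (L `<=` nbhd r L)%fset.
Proof. by apply/fsubsetP => x xL; apply: (mem_nbhd xL); rewrite subrr box0. Qed.

Lemma nbhd_sub r L M : (L `<=` M)%fset -> (nbhd r L `<=` nbhd r M)%fset.
Proof.
move=> /fsubsetP LM; apply/fsubsetP => x /nbhdP[y /LM yM xy]; exact: mem_nbhd xy.
Qed.

Lemma nbhd_box n r : (nbhd r (box d n) `<=` box d (n + r))%fset.
Proof.
by apply/fsubsetP => x /nbhdP[y yn xy]; rewrite -(subrK y x) addnC box_addr.
Qed.

Lemma nbhd_disjoint_box n r L : [disjoint L & box d (n + r)]%fset ->
  [disjoint nbhd r L & box d n]%fset.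
Proof.
move=> /fdisjointP h; apply/fdisjointP => x /nbhdP[y yL xy].
apply: contra (h _ yL) => xn.
by rewrite -[y](subrK x) addnC box_addr// -box_opp opprB.
Qed.

Lemma nbhd_sym r L M : [disjoint nbhd r L & M]%fset -> [disjoint L & nbhd r M]%fset.
Proof.
move=> /fdisjointP h; apply/fdisjointP => x xL; apply/negP => /nbhdP[y yM xy].
have yL : y \in nbhd r L by apply: (mem_nbhd xL); rewrite -box_opp opprB.
by move: (h y yL); rewrite yM.
Qed.

End Boxes.

Section Energy.
Variables (R : realType) (d : nat) (E E' : pfinType).
Variables (Phi : finite_range_potential R d E E') (r : nat).
Hypothesis Phi_range : forall A : {fset site d}, (r < diam A)%N -> forall xi, Phi A xi = 0.
Implicit Types (L M N : {fset site d}) (xi : config d (E * E')%type).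

Lemma pot_nbhd L (A : {fset site d}) : (A `&` L)%fset != fset0 ->
  (A `<=` nbhd r L)%fset \/ (forall xi, Phi A xi = 0).
Proof.
move=> /fset0Pn[x]; rewrite inE => /andP[xA xL].
case: (ltnP r (diam A)) => [rA|Ar]; [by right; exact: Phi_range|left].
apply/fsubsetP => y yA; apply: (mem_nbhd xL); apply/in_boxP => i; rewrite !mxE.
apply: leq_trans Ar; apply: (@leq_trans (dist y x)).
  exact: (leq_bigmax (F := fun i => `|y 0%R i - x 0%R i|%N)).
rewrite /diam (big_rem y)//= leq_max; apply/orP; left.
by rewrite (big_rem x)//= leq_max leqnn.
Qed.

Lemma energyE L N xi : (nbhd r L `<=` N)%fset ->
  energy Phi L xi = \sum_(A <- fpowerset N | (A `&` L)%fset != fset0) Phi A xi.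
Proof.
move=> LN; rewrite /energy [RHS]bigfs//.
move=> A AL; rewrite fpowersetE => AN.
by case: (pot_nbhd AL) => [h|->//]; rewrite (fsubset_trans h LN) in AN.
Qed.

Lemma depends_on_energy L : depends_on (nbhd r L) (energy Phi L).
Proof.
move=> xi xi' e; rewrite !(energyE _ (fsubset_refl _)) big_seq_cond [RHS]big_seq_cond.
apply: eq_bigr => A /andP[]; rewrite fpowersetE => /fsubsetP AN _.
by apply: pot_local => x /AN; exact: e.
Qed.

(** Only the sets that meet [M] see a change of configuration inside [M]. *)
Lemma energy_diff L M xi xi' : (M `<=` L)%fset ->
  (forall x, x \notin M -> xi x = xi' x) ->
  energy Phi L xi - energy Phi L xi' = energy Phi M xi - energy Phi M xi'.
Proof.
move=> ML e; have MN := nbhd_sub r ML.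
rewrite (energyE _ (fsubset_refl (nbhd r L))) (energyE _ (fsubset_refl (nbhd r L))).
rewrite !(energyE _ MN) -!sumrB [LHS]big_mkcond [RHS]big_mkcond.
apply: eq_bigr => A _; case: (boolP (_ != _)) => [AL|]; last first.
  rewrite negbK => /eqP AL; rewrite ifF//; apply/negbTE; rewrite negbK -fsubset0 -AL.
  exact: fsetIS.
case: ifPn => //; rewrite negbK => /eqP AM; apply/eqP; rewrite subr_eq0.
apply/eqP/pot_local => x xA; apply: e; apply/negP => xM.
have : x \in (A `&` M)%fset by rewrite inE xA.
by rewrite AM inE.
Qed.

(** No set of diameter at most [r] meets both volumes. *)
Lemma energyU L M xi : [disjoint nbhd r L & M]%fset ->
  energy Phi (L `|` M)%fset xi = energy Phi L xi + energy Phi M xi.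
Proof.
move=> dLM; set N := nbhd r (L `|` M)%fset.
have LN : (nbhd r L `<=` N)%fset by apply: nbhd_sub; exact: fsubsetUl.
have MN : (nbhd r M `<=` N)%fset by apply: nbhd_sub; exact: fsubsetUr.
rewrite (energyE _ LN) (energyE _ MN) (energyE _ (fsubset_refl N)).
rewrite big_mkcond [X in _ = X + _]big_mkcond [X in _ = _ + X]big_mkcond -big_split.
apply: eq_bigr => A _ /=; rewrite fsetIUr fsetU_eq0 negb_and.
case: (boolP (A `&` L == fset0)%fset) => [_|AL]/=; first by rewrite add0r.
case: (boolP (A `&` M == fset0)%fset) => [_|/fset0Pn[x]]/=; first by rewrite addr0.
rewrite inE => /andP[xA xM].
case: (pot_nbhd AL) => [/fsubsetP AN|->]; last by rewrite addr0.
by move/fdisjointP : dLM => /(_ x (AN x xA)); rewrite xM.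
Qed.

Definition weight L xi : R := expR (- energy Phi L xi).

Lemma weight_gt0 L xi : 0 < weight L xi.
Proof. exact: expR_gt0. Qed.

Lemma depends_on_weight L : depends_on (nbhd r L) (weight L).
Proof. by move=> xi xi' e; rewrite /weight (depends_on_energy e). Qed.

(** The consistency of the Gibbs specification, in a form without quotients. *)
Lemma weight_diff L M xi xi' : (M `<=` L)%fset ->
  (forall x, x \notin M -> xi x = xi' x) ->
  weight L xi * weight M xi' = weight L xi' * weight M xi.
Proof.
move=> ML e; rewrite /weight -!expRD; congr expR.
by have := energy_diff ML e; lra.
Qed.

Lemma weightU L M xi : [disjoint nbhd r L & M]%fset ->
  weight (L `|` M)%fset xi = weight L xi * weight M xi.
Proof. by move=> h; rewrite /weight energyU// opprD expRD. Qed.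

End Energy.

(** * Gibbs measures with a frozen shell *)

Section Gibbs.
Variables (R : realType) (d : nat) (E E' : pfinType).
Variables (Phi : finite_range_potential R d E E') (r : nat).
Hypothesis Phi_range : forall A : {fset site d}, (r < diam A)%N -> forall xi, Phi A xi = 0.
Implicit Types (L M D V : {fset site d}) (sigma bc t : config d E) (eta : config d E').
Implicit Types (g : config d E -> R).

Local Notation w L eta := (fun sigma => weight Phi L (joint sigma eta)).

Lemma gibbsE L bc eta B : gibbs Phi L bc eta B =
  spin_sum L (fun sigma => \1_B sigma * w L eta sigma) bc / spin_sum L (w L eta) bc.
Proof. by rewrite /gibbs mulrC. Qed.

Lemma depends_on_gibbs L bc B :
  depends_on (nbhd r L) (fun eta => gibbs Phi L bc eta B).
Proof.
move=> eta eta' e; rewrite !gibbsE.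
have we sigma : w L eta sigma = w L eta' sigma.
  by apply: (depends_on_weight Phi_range) => x xL; rewrite /joint e.
congr (_ / _); apply: eq_spin_sum => sigma _; last exact: we.
by rewrite [w L eta sigma]we.
Qed.

(** The volume [L] is cut into a core [L1], an outer part [L2] out of reach of
    the core, and a shell [D] separating them, on which the spins are frozen to
    [t] at cost [C]. *)
Section Freezing.
Variables (D L1 L2 : {fset site d}) (bc t : config d E) (eta : config d E') (C : R).
Let M := (L1 `|` L2)%fset.
Let L := (D `|` M)%fset.
Hypotheses (dDM : [disjoint D & M]%fset) (d12 : [disjoint nbhd r L1 & L2]%fset).
Hypothesis C0 : 0 <= C.
Hypothesis wC : forall sigma, w L eta sigma <= C * w L eta (overwrite D t sigma).
Let kappa := (#|E| ^ #|` D|)%:R * C.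
Let frozen := overwrite D t bc.

Lemma frozen_le g : (forall z, 0 <= g z) -> (forall z, g (overwrite D t z) = g z) ->
  spin_sum L (fun z => g z * w L eta z) bc
    <= kappa * spin_sum M (fun z => g z * w L eta z) frozen.
Proof.
move=> g0 gD; apply: spin_sum_freeze_le => // z.
by rewrite /= mulrCA gD ler_wpM2l ?wC.
Qed.

Lemma frozen_ge g : (forall z, 0 <= g z) ->
  spin_sum M (fun z => g z * w L eta z) frozen
    <= spin_sum L (fun z => g z * w L eta z) bc.
Proof.
move=> g0; apply: spin_sum_freeze_ge => // z.
by rewrite mulr_ge0// ltW// weight_gt0.
Qed.

(** With the shell frozen, core and outer part do not interact, and the remaining
    energy is the same for all configurations in the sum. It is the
    prefactor, which cancels in quotients. *)
Lemma frozen_prod A B g1 g2 : (A `<=` L1)%fset -> [disjoint B & L1]%fset ->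
  depends_on A g1 -> depends_on B g2 ->
  spin_sum M (fun z => g1 z * g2 z * w L eta z) frozen =
  w L eta frozen / w M eta frozen *
    (spin_sum L1 (fun z => g1 z * w L1 eta z) frozen *
     spin_sum L2 (fun z => g2 z * w L2 eta z) frozen).
Proof.
move=> AL1 BL1 g1A g2B.
have ? : [disjoint L1 & L2]%fset.
  by apply: fdisjointWl d12; exact: subset_nbhd.
rewrite -(@spin_sum_prod _ _ _ _ _ (nbhd r L1) (B `|` nbhd r L2)%fset)//; last 3 first.
- by rewrite fdisjointUX BL1 fdisjoint_sym nbhd_sym.
- move=> z z' e; congr (_ * _).
    by apply: g1A => x /(fsubsetP AL1)/(fsubsetP (subset_nbhd r L1)); exact: e.
  by apply: (depends_on_weight Phi_range) => x xL; rewrite /joint e.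
- move=> z z' e; congr (_ * _).
    by apply: g2B => x xB; apply: e; rewrite inE xB.
  by apply: (depends_on_weight Phi_range) => x xL; rewrite /joint e// inE xL orbT.
rewrite -spin_sumZ; apply: eq_spin_sum => z e.
rewrite /= (mulrACA (g1 z)) -(weightU Phi_range)// -/M mulrCA; congr (_ * _).
rewrite mulrAC; apply: (canRL (mulfK _)); first by rewrite gt_eqF// weight_gt0.
rewrite [LHS](weight_diff Phi_range (M := M)) ?fsubsetUr// => x xM.
by rewrite /joint e.
Qed.

(** The Gibbs measure conditioned on the frozen shell is the product of the Gibbs
    measures of core and outer part. *)
Lemma frozen_gibbs A B g1 g2 : (A `<=` L1)%fset -> [disjoint B & L1]%fset ->
  depends_on A g1 -> depends_on B g2 ->
  spin_sum M (fun z => g1 z * g2 z * w L eta z) frozen / spin_sum M (w L eta) frozen =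
  (spin_sum L1 (fun z => g1 z * w L1 eta z) frozen / spin_sum L1 (w L1 eta) frozen) *
  (spin_sum L2 (fun z => g2 z * w L2 eta z) frozen / spin_sum L2 (w L2 eta) frozen).
Proof.
move=> AL1 BL1 g1A g2B; rewrite (frozen_prod AL1 BL1)//.
have one K : spin_sum K (w L eta) frozen =
  spin_sum K (fun z => 1 * 1 * w L eta z) frozen.
  by apply: eq_spin_sum => z _; rewrite !mul1r.
have onei K : spin_sum K (fun z => 1 * w K eta z) frozen = spin_sum K (w K eta) frozen.
  by apply: eq_spin_sum => z _; rewrite !mul1r.
rewrite one (frozen_prod AL1 BL1)// !onei.
have Z0 K : spin_sum K (w K eta) frozen != 0.
  by rewrite gt_eqF// spin_sum_gt0// => z; exact: weight_gt0.
have W0 K : w K eta frozen != 0 by rewrite gt_eqF// weight_gt0.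
by field; rewrite !Z0 !W0.
Qed.

Variables (V : {fset site d}) (sigma : config d E).
Hypotheses (VL : [disjoint V & D `|` L1]%fset).

Let VL1 : [disjoint V & L1]%fset.
Proof. by move: VL; rewrite fdisjointXU => /andP[]. Qed.

Let ind (W : {fset site d}) : config d E -> R := \1_(agree W sigma).

Let ind0 W z : 0 <= ind W z. Proof. by []. Qed.

Let indW W : depends_on W (ind W).
Proof. exact: depends_on_indic. Qed.

Let indD W z : [disjoint W & D]%fset -> ind W (overwrite D t z) = ind W z.
Proof.
move=> /fdisjointP WD; apply: indW => x xW.
by rewrite overwrite_out// WD.
Qed.

Let L1D : [disjoint L1 & D]%fset.
Proof. by move: dDM; rewrite fdisjointXU fdisjoint_sym => /andP[]. Qed.

Let VD : [disjoint V & D]%fset.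
Proof. by move: VL; rewrite fdisjointXU => /andP[]. Qed.

Let Z0 K K' z : 0 < spin_sum K (w K' eta) z.
Proof. by rewrite spin_sum_gt0// => z'; exact: weight_gt0. Qed.

Let one_le : spin_sum L (w L eta) bc <= kappa * spin_sum M (w L eta) frozen.
Proof.
have := @frozen_le (fun=> 1) (fun=> ler01) (fun=> erefl).
by under eq_spin_sum do rewrite mul1r; under [in leRHS]eq_spin_sum do rewrite mul1r.
Qed.

Let one_ge : spin_sum M (w L eta) frozen <= spin_sum L (w L eta) bc.
Proof.
have := @frozen_ge (fun=> 1) (fun=> ler01).
by under eq_spin_sum do rewrite mul1r; under [in leRHS]eq_spin_sum do rewrite mul1r.
Qed.

Let kappa0 : 0 <= kappa. Proof. by rewrite mulr_ge0. Qed.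

Let gibbs1 : gibbs Phi L1 frozen eta (agree L1 sigma) =
  spin_sum M (fun z => ind L1 z * w L eta z) frozen / spin_sum M (w L eta) frozen.
Proof.
have := @frozen_gibbs L1 fset0 (ind L1) (fun=> 1) (fsubset_refl _) (fdisjoint0X _)
  (@indW _) (fun _ _ _ => erefl).
under eq_spin_sum do rewrite mulr1; move=> ->; rewrite gibbsE.
by under [X in _ * (X / _)]eq_spin_sum do rewrite mul1r; rewrite divff ?mulr1 ?gt_eqF.
Qed.

Let gibbs2 : gibbs Phi L2 frozen eta (agree V sigma) =
  spin_sum M (fun z => ind V z * w L eta z) frozen / spin_sum M (w L eta) frozen.
Proof.
have := @frozen_gibbs fset0 V (fun=> 1) (ind V) (fsub0set _) VL1
   (fun _ _ _ => erefl) (@indW _).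
under eq_spin_sum do rewrite mul1r; move=> ->; rewrite [LHS]gibbsE.
by under [X in _ = X / _ * _]eq_spin_sum do rewrite mul1r; rewrite divff ?mul1r ?gt_eqF.
Qed.

Let gibbs_ge W : [disjoint W & D]%fset ->
  spin_sum M (fun z => ind W z * w L eta z) frozen / spin_sum M (w L eta) frozen <=
  kappa * gibbs Phi L bc eta (agree W sigma).
Proof.
move=> WD; rewrite gibbsE ler_pdivrMr// -mulrA mulrCA.
apply: (le_trans (frozen_ge (ind0 W))).
apply: (@le_trans _ _ (spin_sum L (fun z => ind W z * w L eta z) bc *
  (kappa * spin_sum M (w L eta) frozen / spin_sum L (w L eta) bc))).
  rewrite ler_peMr ?ler_pdivlMr ?mul1r//.
  by apply: spin_sum_ge0 => z; rewrite mulr_ge0 ?ind0// ltW// weight_gt0.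
rewrite le_eqVlt; apply/orP; left; apply/eqP.
by field; rewrite gt_eqF.
Qed.

Lemma gibbs_frozen1 : gibbs Phi L1 frozen eta (agree L1 sigma) <=
  kappa * gibbs Phi L bc eta (agree L1 sigma).
Proof. by rewrite gibbs1 gibbs_ge. Qed.

Lemma gibbs_frozen2 : gibbs Phi L2 frozen eta (agree V sigma) <=
  kappa * gibbs Phi L bc eta (agree V sigma).
Proof. by rewrite gibbs2 gibbs_ge. Qed.

(** The first factor depends on the disorder near the core only, the second on the
    disorder near the outer part only ([depends_on_gibbs]); this is what allows
    the decoupling of the disorder to be used. *)
Lemma gibbs_frozen_prod : gibbs Phi L bc eta (agree (L1 `|` V)%fset sigma) <=
  kappa * (gibbs Phi L1 frozen eta (agree L1 sigma) *
           gibbs Phi L2 frozen eta (agree V sigma)).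
Proof.
have UD : [disjoint L1 `|` V & D]%fset by rewrite fdisjointUX L1D VD.
have indU z : ind (L1 `|` V)%fset z = ind L1 z * ind V z.
  by rewrite /ind agreeU indicI.
have := @frozen_gibbs L1 V (ind L1) (ind V) (fsubset_refl _) VL1
  (@indW _) (@indW _).
rewrite -!gibbsE => <-.
under [in leRHS]eq_spin_sum do rewrite -indU.
rewrite gibbsE ler_pdivrMr//.
apply: (le_trans (frozen_le (ind0 _) _)); first by move=> z; rewrite indD.
rewrite -[leRHS]mulrA ler_wpM2l// mulrAC -mulrA ler_peMr ?ler_pdivlMr ?mul1r//.
by apply: spin_sum_ge0 => z; rewrite mulr_ge0 ?ind0// ltW// weight_gt0.
Qed.

End Freezing.
End Gibbs.

(** * Decoupling of the finite-volume joint measures *)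

Section Quenched.
Variables (R : realType) (d : nat) (E E' : pfinType).
Variables (Phi : finite_range_potential R d E E') (r : nat).
Hypothesis Phi_range : forall A : {fset site d}, (r < diam A)%N -> forall xi, Phi A xi = 0.
Variable P : probability (config d E') R.
Implicit Types (L D V W : {fset site d}) (sigma bc t : config d E) (eta : config d E').
Implicit Types (xi : config d (E * E')%type).

Definition spins xi : config d E := fun x => (xi x).1.
Definition disorder xi : config d E' := fun x => (xi x).2.

Lemma agree_joint W xi sigma eta : agree W xi (joint sigma eta) <->
  agree W (spins xi) sigma /\ agree W (disorder xi) eta.
Proof.
split=> [h|[h h'] x xW]; last by rewrite /joint h// h'// -surjective_pairing.
by split => x xW; have := h x xW; rewrite /spins /disorder => <-.
Qed.

(** Patterns of zero probability may be ignored: this is the almost sure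
    comparison of integrals. *)
Lemma le_expect W (f g : config d E' -> R) :
  (forall eta, 0 < pr P W eta -> f eta <= g eta) -> expect P W f <= expect P W g.
Proof.
move=> fg; apply: le_spin_sum => z _.
have := pr_ge0 P W z; rewrite le_eqVlt => /orP[/eqP <-|Pz]; first by rewrite !mul0r.
by rewrite ler_wpM2l ?(ltW Pz)// fg.
Qed.

Lemma expectZ W c (f : config d E' -> R) :
  expect P W (fun eta => c * f eta) = c * expect P W f.
Proof. by rewrite /expect -spin_sumZ; apply: eq_spin_sum => z _; rewrite mulrCA. Qed.

Lemma expect_ge0 W (f : config d E' -> R) :
  (forall eta, 0 <= f eta) -> 0 <= expect P W f.
Proof. by move=> f0; apply: spin_sum_ge0 => z; rewrite mulr_ge0// pr_ge0. Qed.

Lemma gibbs_joint L bc W xi eta :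
  gibbs Phi L bc eta [set sigma | agree W xi (joint sigma eta)] =
  \1_(agree W (disorder xi)) eta * gibbs Phi L bc eta (agree W (spins xi)).
Proof.
rewrite [RHS]mulrCA /gibbs; congr (_ * _); rewrite mulr_sumr; apply: eq_bigr => s _.
rewrite mulrA; congr (_ * _); rewrite !indicE -natrM mulnb; congr (_%:R).
congr (nat_of_bool _); apply/idP/andP; rewrite !inE /=.
  by move=> /agree_joint[h1 h2]; split.
by move=> [h2 h1]; apply/agree_joint; split.
Qed.

Lemma pr_quenched L bc W W' xi : (W `|` nbhd r L `<=` W')%fset ->
  pr (quenched_joint P Phi L bc) W xi =
  expect P W' (fun eta => \1_(agree W (disorder xi)) eta *
                          gibbs Phi L bc eta (agree W (spins xi))).
Proof.
rewrite fsubUset => /andP[WW' LW'].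
rewrite /pr /= /quenched_joint; under eq_integral do rewrite gibbs_joint.
rewrite (@integral_local _ _ _ P W' _ point)//.
- apply: depends_onM; first exact: depends_on_indic.
  by apply: depends_onS (depends_on_gibbs Phi_range _ _); assumption.
- by move=> eta; rewrite mulr_ge0// gibbs_ge0.
Qed.

(** Three factors [(#|E| ^ #|` D|)%:R * C] are paid: one to freeze the shell in the
    joint event, and one to return to each of the two marginals after the
    integral over the disorder has been split. *)
Lemma quenched_decoupled (D L1 L2 V W : {fset site d}) (bc t : config d E)
    (C c : R) (n k : nat) :
  [disjoint D & L1 `|` L2]%fset -> [disjoint nbhd r L1 & L2]%fset ->
  [disjoint V & D `|` L1]%fset ->
  (nbhd r L1 `<=` box d n)%fset -> (n <= k)%N ->
  [disjoint V `|` nbhd r L2 & box d k]%fset ->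
  (forall X M z, (X `<=` box d n)%fset -> [disjoint M & box d k]%fset ->
    pr P (X `|` M)%fset z <= expR c * (pr P X z * pr P M z)) ->
  0 <= C ->
  (forall eta sigma, 0 < pr P W eta ->
    weight Phi (D `|` (L1 `|` L2))%fset (joint sigma eta) <=
    C * weight Phi (D `|` (L1 `|` L2))%fset (joint (overwrite D t sigma) eta)) ->
  forall xi, pr (quenched_joint P Phi (D `|` (L1 `|` L2))%fset bc) (L1 `|` V)%fset xi <=
    ((#|E| ^ #|` D|)%:R * C) ^+ 3 * expR c *
    (pr (quenched_joint P Phi (D `|` (L1 `|` L2))%fset bc) L1 xi *
     pr (quenched_joint P Phi (D `|` (L1 `|` L2))%fset bc) V xi).
Proof.
move=> dDM d12 VDL L1n nk VLk dec C0 wC xi.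
set L := (D `|` (L1 `|` L2))%fset in wC *; set kappa := _%:R * C.
have k0 : 0 <= kappa by rewrite mulr_ge0.
pose W' := (W `|` (L1 `|` V `|` nbhd r L))%fset.
have sL i : i \in L1 \/ i \in L2 -> i \in L by rewrite !inE => -[] ->; rewrite !orbT.
have WW' : (W `<=` W')%fset by exact: fsubsetUl.
have LW' X : (X `<=` L1 `|` V)%fset -> (X `|` nbhd r L `<=` W')%fset.
  by move=> XLV; apply: fsubset_trans (fsubsetUr _ _); exact: fsetSU.
rewrite !(@pr_quenched L bc _ W') ?LW' ?fsubsetUl ?fsubsetUr//.
(* [F] and [G] are the factors of the frozen Gibbs measure together with the
   disorder events; they depend on separated parts of the disorder. *)
pose F eta := \1_(agree L1 (disorder xi)) eta *
  gibbs Phi L1 (overwrite D t bc) eta (agree L1 (spins xi)).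
pose G eta := \1_(agree V (disorder xi)) eta *
  gibbs Phi L2 (overwrite D t bc) eta (agree V (spins xi)).
have F0 eta : 0 <= F eta by rewrite mulr_ge0// gibbs_ge0.
have G0 eta : 0 <= G eta by rewrite mulr_ge0// gibbs_ge0.
have wC' eta : 0 < pr P W' eta -> forall sigma,
    weight Phi L (joint sigma eta) <= C * weight Phi L (joint (overwrite D t sigma) eta).
  move=> pW' sigma; apply: wC; apply: lt_le_trans pW' _; exact: pr_sub.
apply: (@le_trans _ _ (expect P W' (fun eta => kappa * (F eta * G eta)))).
  apply: le_expect => eta /wC' w'.
  have -> : kappa * (F eta * G eta) = \1_(agree (L1 `|` V)%fset (disorder xi)) eta *
      (kappa * (gibbs Phi L1 (overwrite D t bc) eta (agree L1 (spins xi)) *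
                gibbs Phi L2 (overwrite D t bc) eta (agree V (spins xi)))).
    by rewrite /F /G agreeU indicI /=; ring.
  rewrite ler_wpM2l//; exact: (gibbs_frozen_prod Phi_range).
rewrite expectZ.
pose FF eta := \1_(agree L1 (disorder xi)) eta * gibbs Phi L bc eta (agree L1 (spins xi)).
pose GG eta := \1_(agree V (disorder xi)) eta * gibbs Phi L bc eta (agree V (spins xi)).
have FFF : expect P W' F <= kappa * expect P W' FF.
  rewrite -expectZ; apply: le_expect => eta /wC' w'; rewrite /F /FF [leRHS]mulrCA ler_wpM2l//.
  exact: (gibbs_frozen1 Phi_range).
have GGG : expect P W' G <= kappa * expect P W' GG.
  rewrite -expectZ; apply: le_expect => eta /wC' w'; rewrite /G /GG [leRHS]mulrCA ler_wpM2l//.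
  exact: (gibbs_frozen2 Phi_range).
clearbody kappa; rewrite exprSr expr2 -!mulrA ler_wpM2l//.
apply: (@le_trans _ _ (expR c * (expect P W' F * expect P W' G))).
  apply: (@decoupled_expect _ _ _ P W' (nbhd r L1) (V `|` nbhd r L2)%fset (expR c) F G) => //.
  - apply: fsubset_trans (fsubsetUr _ _); apply: fsubset_trans (fsubsetUr _ _).
    by apply: nbhd_sub; apply/fsubsetP => x xL; apply: sL; left.
  - rewrite fsubUset; apply/andP; split.
      by apply: fsubset_trans (fsubsetUr _ _); rewrite -fsetUA fsetUCA fsubsetUl.
    apply: fsubset_trans (fsubsetUr _ _); apply: fsubset_trans (fsubsetUr _ _).
    by apply: nbhd_sub; apply/fsubsetP => x xL; apply: sL; right.
  - rewrite fdisjoint_sym; apply: fdisjointWr VLk.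
    exact: fsubset_trans L1n (box_subset _ nk).
  - apply: depends_onM; last exact: (depends_on_gibbs Phi_range).
    by apply: depends_on_indic; exact: subset_nbhd.
  - apply: depends_onM; first by apply: depends_on_indic; exact: fsubsetUl.
    apply: depends_onS (depends_on_gibbs Phi_range _ _); exact: fsubsetUr.
  - by move=> z; exact: dec.
have -> : kappa * (kappa * (expR c * (expect P W' FF * expect P W' GG))) =
  expR c * ((kappa * expect P W' FF) * (kappa * expect P W' GG)) by ring.
by rewrite ler_wpM2l ?expR_ge0// ler_pM// expect_ge0.
Qed.

End Quenched.

(** * Passage to the limit and uniform cost of a spin flip *)

Lemma fset_splitl (K : choiceType) (A B : {fset K}) : (A `<=` B)%fset ->
  B = (A `|` (B `\` A))%fset.
Proof.
move=> /fsubsetP AB; apply/fsetP => x; rewrite !inE.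
by case: (boolP (x \in A)) => //= /AB.
Qed.

Section WeakLimit.
Variables (R : realType) (d : nat) (E E' : pfinType).
Implicit Types (L : {fset site d}) (xi : config d (E * E')%type).

Lemma nbhs_agree L xi : nbhs xi (agree L xi).
Proof.
have site_nbhs x : nbhs xi [set z : config d (E * E')%type | z x = xi x].
  have proj_cont := @proj_continuous (site d)
    (fun=> discrete_topology (E * E')%type : topologicalType) x.
  have single : nbhs (xi x : discrete_topology (E * E')%type) [set xi x].
    exact: discrete_set1.
  exact: (proj_cont xi _ single).
rewrite (_ : agree L xi = \bigcap_(x in [set` L]) [set z | z x = xi x]); last first.
  by apply/seteqP; split.
by apply: filter_bigI => x _.
Qed.

Lemma continuous_local L (f : config d (E * E')%type -> R) :
  depends_on L f -> continuous f.
Proof.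
move=> fL xi U /nbhs_singleton Ufx; apply: filterS (nbhs_agree L xi) => z zx.
by rewrite /= (fL z xi).
Qed.

Variables (K_ : nat -> probability (config d (E * E')%type) R).
Variable K : probability (config d (E * E')%type) R.

Lemma weak_cvg_pr L xi : weak_cvg K_ K ->
  (fun N => pr (K_ N) L xi) @ \oo --> pr K L xi.
Proof.
move=> /(_ (\1_(agree L xi))) h.
have loc := @depends_on_indic R _ _ L L xi (fsubset_refl _).
have : (fun N => (pr (K_ N) L xi)%:E) @ \oo --> (pr K L xi)%:E.
  rewrite -prE -(setIT (agree L xi)) -integral_indic//; last exact: measurable_agree.
  rewrite (_ : (fun N => _) = (fun N => \int[K_ N]_z (\1_(agree L xi) z)%:E)%E).
    apply: h; first exact: continuous_local loc.
    by have [C _ bC] := depends_on_bounded loc; exists C.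
  apply/funext => N; rewrite -prE integral_indic// ?setIT//.
  exact: measurable_agree.
by move/fine_cvg.
Qed.

End WeakLimit.

Section JointMeasure.
Variables (R : realType) (d : nat) (E E' : pfinType).
Variables (Phi : finite_range_potential R d E E') (r : nat).
Hypothesis Phi_range : forall A : {fset site d}, (r < diam A)%N -> forall xi, Phi A xi = 0.
Variables (P : probability (config d E') R) (bc : config d E).
Variable K : probability (config d (E * E')%type) R.
Hypothesis KP : joint_measure P Phi bc K.
Implicit Types (L D V W : {fset site d}) (sigma t : config d E) (eta : config d E').
Implicit Types (xi : config d (E * E')%type).

Lemma exhaustion (L : nat -> {fset site d}) W :
  (forall N, (L N `<=` L N.+1)%fset) -> (forall x, exists N, x \in L N) ->
  \forall N \near \oo, (W `<=` L N)%fset.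
Proof.
move=> Lmono Lex.
have mono N M : (N <= M)%N -> (L N `<=` L M)%fset.
  move=> /subnK <-; elim: (M - N)%N => [|k IH]; first by rewrite add0n.
  exact: fsubset_trans IH (Lmono _).
have : \forall N \near \oo, (\bigcap_(x in [set` W]) [set N | x \in L N]) N.
  apply: filter_bigI => x _; have [N xN] := Lex x.
  by exists N => // M /= NM; exact: (fsubsetP (mono _ _ NM)).
by apply: filterS => N h; apply/fsubsetP => x; exact: h.
Qed.

Lemma joint_measure_cvg W : exists L : nat -> {fset site d},
  (\forall N \near \oo, (W `<=` L N)%fset) /\
  forall V xi, (fun N => pr (quenched_joint P Phi (L N) bc) V xi) @ \oo --> pr K V xi.
Proof.
have [L [Lmono Lex LK]] := KP; exists L; split; first exact: exhaustion.
by move=> V xi; exact: (@weak_cvg_pr _ _ _ _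
  (fun N => quenched_joint P Phi (L N) bc : probability _ _)).
Qed.

Lemma expect_indic W W' eta : (W `<=` W')%fset ->
  expect P W' (\1_(agree W eta)) = pr P W eta.
Proof.
move=> WW'; rewrite (expect_indep P WW'); last exact: depends_on_indic.
rewrite /expect; under eq_spin_sum do rewrite mulrC.
by rewrite spin_sum_indic; apply: depends_on_pr => x xW; rewrite overwrite_in.
Qed.

Lemma weight_bounded W : exists2 C, 0 < C &
  forall xi xi', weight Phi W xi <= C * weight Phi W xi'.
Proof.
have loc := depends_on_weight Phi_range (L := W).
have [C1 C10 bC1] := depends_on_bounded loc.
have [C2 C20 bC2] := depends_on_min loc.
exists (C1 / C2) => [|xi xi']; first by rewrite divr_gt0.
apply: le_trans (le_trans (ler_norm _) (bC1 _)) _.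
by rewrite -mulrA ler_peMr ?(ltW C10)// mulrC ler_pdivlMr// mul1r bC2// weight_gt0.
Qed.

(** A bound for the weights of a small volume carries over to any larger one,
    since the weight ratios are the same. *)
Lemma weight_bounded_sub W L xi xi' C : (W `<=` L)%fset ->
  (forall x, x \notin W -> xi x = xi' x) ->
  weight Phi W xi <= C * weight Phi W xi' -> weight Phi L xi <= C * weight Phi L xi'.
Proof.
move=> WL e wC; rewrite -(ler_pM2r (weight_gt0 Phi W xi')).
rewrite (weight_diff Phi_range WL e) -mulrA mulrCA ler_pM2l ?weight_gt0//.
Qed.

(** In every finite volume the spins of [W] can be changed to any pattern at a
    cost depending on [W] only, whatever the disorder. The bound may
    depend on the position of [W]; it is only used to know that
    patterns compatible with the disorder have positive probability. *)
Lemma finite_energy W : exists2 kappa, 0 < kappa &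
  forall sigma eta, pr P W eta <= kappa * pr K W (joint sigma eta).
Proof.
have [C C0 wC] := weight_bounded W.
exists ((#|E| ^ #|` W|)%:R * C).
  rewrite mulr_gt0// ltr0n expn_gt0; apply/orP; left; apply/card_gt0P.
  by exists point.
move=> sigma eta; set kappa := _ * C.
have [L [WL LK]] := joint_measure_cvg W.
have cv : (fun N => kappa * pr (quenched_joint P Phi (L N) bc) W (joint sigma eta))
    @ \oo --> kappa * pr K W (joint sigma eta).
  by apply: cvgM; [exact: cvg_cst|exact: LK].
rewrite -(cvg_lim _ cv)//; apply: limr_ge; first exact: cvgP cv.
near=> N.
have WLN : (W `<=` L N)%fset by near: N.
have LE : L N = (W `|` (L N `\` W))%fset by exact: fset_splitl.
set W' := (W `|` nbhd r (L N))%fset.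
rewrite (@pr_quenched _ _ _ _ _ _ Phi_range P (L N) bc W W' _ (fsubset_refl _)).
rewrite -expectZ -(@expect_indic W W') ?fsubsetUl//.
apply: le_expect => eta' _; rewrite [leRHS]mulrCA ler_peMr//.
rewrite gibbsE mulrA ler_pdivlMr ?mul1r; last first.
  by apply: spin_sum_gt0 => z; exact: weight_gt0.
have dW : [disjoint W & L N `\` W]%fset by apply/fdisjointP => x xW; rewrite inE xW.
rewrite {1 3}LE.
apply: (@le_trans _ _ (kappa * spin_sum (L N `\` W)%fset
    (fun z => weight Phi (L N) (joint z eta')) (overwrite W sigma bc))).
  apply: spin_sum_freeze_le => // z; apply: (weight_bounded_sub WLN); last exact: wC.
  by move=> x xW; rewrite /joint overwrite_out.
rewrite ler_wpM2l ?mulr_ge0 ?(ltW C0)//.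
apply: le_trans (spin_sum_freeze_ge sigma bc dW _); last first.
  by move=> z; rewrite mulr_ge0// ltW// weight_gt0.
apply: le_spin_sum => z e; rewrite indicE mem_set ?mul1r// => x xW.
by rewrite e ?overwrite_in// inE xW.
Unshelve. all: by end_near.
Qed.

(** The probabilities of two patterns on [W] that differ in the spin at [x] are in
    the ratio of the weights of the sets containing [x], because [W] contains
    everything these weights depend on. The relation is exact in finite volume
    and survives the weak limit. *)
Lemma spin_ratio x sigma eta t W : W = nbhd r [fset x]%fset ->
  weight Phi [fset x]%fset (joint sigma eta) *
    pr K W (joint (overwrite [fset x]%fset t sigma) eta) <=
  weight Phi [fset x]%fset (joint (overwrite [fset x]%fset t sigma) eta) *
    pr K W (joint sigma eta).
Proof.
move=> WE; set sigma' := overwrite _ t sigma; set X := [fset x]%fset in WE sigma' *.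
have XW : (X `<=` W)%fset by rewrite WE subset_nbhd.
have [L [XL LK]] := joint_measure_cvg X.
have cv s : (fun N => weight Phi X (joint (if s then sigma else sigma') eta) *
     pr (quenched_joint P Phi (L N) bc) W (joint (if s then sigma' else sigma) eta))
    @ \oo --> weight Phi X (joint (if s then sigma else sigma') eta) *
     pr K W (joint (if s then sigma' else sigma) eta).
  by apply: cvgM; [exact: cvg_cst|exact: LK].
rewrite -(cvg_lim _ (cv true))// -(cvg_lim _ (cv false))//.
apply: ler_lim; [exact: cvgP (cv true)|exact: cvgP (cv false)|].
near=> N => /=.
have XLN : (X `<=` L N)%fset by near: N.
have LE : L N = ((L N `\` X) `|` X)%fset.
  by rewrite fsetUC -fset_splitl.
set W' := (W `|` nbhd r (L N))%fset.
rewrite !(@pr_quenched _ _ _ _ _ _ Phi_range P (L N) bc W W' _ (fsubset_refl _)).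
rewrite -!expectZ; apply: le_expect => eta' _.
rewrite [leLHS]mulrCA [leRHS]mulrCA.
rewrite -/(disorder (joint sigma eta)) (_ : disorder (joint sigma' eta) = eta)//.
rewrite (_ : disorder (joint sigma eta) = eta)//.
rewrite (_ : spins (joint sigma' eta) = sigma')// (_ : spins (joint sigma eta) = sigma)//.
rewrite !indicE; case: (boolP (eta' \in agree W eta)); last by rewrite !mul0r.
rewrite inE => eta'W; rewrite ler_wpM2l// !gibbsE !mulrA ler_pM2r; last first.
  by rewrite invr_gt0; apply: spin_sum_gt0 => z; exact: weight_gt0.
have dX : [disjoint L N `\` X & X]%fset by apply/fdisjointP => y; rewrite inE => /andP[].
have sumX tau s : agree (W `\` X)%fset s = agree (W `\` X)%fset sigma ->
    spin_sum X (fun z => \1_(agree W s) z * weight Phi (L N) (joint z eta')) tau =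
    \1_(agree (W `\` X)%fset sigma) tau *
      weight Phi (L N) (joint (overwrite X s tau) eta').
  move=> sE.
  have -> : agree W s = agree (W `\` X)%fset sigma `&` agree X s.
    by rewrite -sE -agreeU fsetUC -fset_splitl.
  rewrite -[in RHS](@spin_sum_indic _ _ _ X (fun z => weight Phi (L N) (joint z eta'))).
  rewrite -(@spin_sum_factor _ _ _ X (\1_(agree (W `\` X)%fset sigma)))//.
    by apply: eq_spin_sum => z _; rewrite indicI mulrA.
  move=> z e; have loc := @depends_on_indic R _ _ _ _ sigma (fsubset_refl (W `\` X)%fset).
  apply: loc => y.
  by rewrite inE => /andP[/e].
(* Both sides are compared after summing over the spin at [x] only. *)
rewrite -!spin_sumZ LE !spin_sumU// -LE.
apply: le_spin_sum => tau _; rewrite !spin_sumZ !sumX//; last first.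
  apply: agree_eq => y; rewrite inE => /andP[yX _]; exact: overwrite_out.
rewrite mulrCA [leRHS]mulrCA !indicE.
case: (boolP (tau \in _)); last by rewrite !mul0r.
rewrite inE => tauW; rewrite ler_wpM2l//.
have tauE s : (forall y, y \notin X -> s y = sigma y) ->
    weight Phi X (joint (overwrite X s tau) eta') = weight Phi X (joint s eta).
  move=> sE; apply: (depends_on_weight Phi_range) => y; rewrite -WE => yW.
  rewrite /joint eta'W// /overwrite; case: ifPn => // yX.
  by rewrite sE// tauW// inE yX.
rewrite -(tauE sigma)// -(tauE sigma'); last by move=> y yX; rewrite /sigma' overwrite_out.
rewrite [leLHS]mulrC [leRHS]mulrC.
rewrite (weight_diff Phi_range XLN) 1?mulrC//.
by move=> y yX; rewrite /joint !overwrite_out.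
Unshelve. all: by end_near.
Qed.

Hypothesis Kinv : translation_invariant K.

(** The potential need not be translation invariant nor bounded, so the uniformity
    in [x] has to come from the joint measure itself. By [spin_ratio] a weight
    ratio is a quotient of probabilities of patterns on a translate of the box
    of radius [r]. By invariance these take finitely many values; hence the
    quotient is at most the inverse of the least positive one. The
    denominator does not vanish, by [finite_energy]. *)
Lemma uniform_spin_ratio : exists2 C, 0 < C & forall x sigma eta t,
  0 < pr P (nbhd r [fset x]%fset) eta ->
  weight Phi [fset x]%fset (joint sigma eta) <=
  C * weight Phi [fset x]%fset (joint (overwrite [fset x]%fset t sigma) eta).
Proof.
have [delta delta0 dP] := depends_on_min (depends_on_pr K (L := box d r)).
exists delta^-1 => [|x sigma eta t eta0]; first by rewrite invr_gt0.
have WE : nbhd r [fset x]%fset = translate x (box d r).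
  apply/fsetP => y; rewrite mem_translate; apply/nbhdP/idP.
    by move=> [z]; rewrite inE => /eqP ->.
  by move=> yx; exists x => //; rewrite inE.
set sigma' := overwrite _ t sigma.
have K0 : 0 < pr K (nbhd r [fset x]%fset) (joint sigma' eta).
  have [kappa k0 kP] := finite_energy (nbhd r [fset x]%fset).
  by rewrite -(pmulr_rgt0 _ k0) (lt_le_trans eta0).
have : delta <= pr K (nbhd r [fset x]%fset) (joint sigma' eta).
  by move: K0; rewrite WE (pr_translate _ _ _ Kinv); exact: dP.
move=> dK; rewrite mulrC ler_pdivlMr//.
apply: (@le_trans _ _ (weight Phi [fset x]%fset (joint sigma eta) *
   pr K (nbhd r [fset x]%fset) (joint sigma' eta))).
  by rewrite ler_wpM2l// ltW// weight_gt0.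
apply: (le_trans (@spin_ratio x sigma eta t _ erefl)).
by rewrite ler_piMr ?pr_le1// ltW// weight_gt0.
Qed.

End JointMeasure.

(** * Decoupling of the joint measure *)

Section JointDecoupling.
Variables (R : realType) (d : nat) (E E' : pfinType).
Variables (P : probability (config d E') R) (Phi : finite_range_potential R d E E').
Variable bc : config d E.
Variable K : probability (config d (E * E')%type) R.
Implicit Types (V : {fset site d}) (xi : config d (E * E')%type).

(** The shell is [box (k + r)] minus [box n]. Its width makes the disorder windows
    of core and outer part fall into [box (n + r)] and off [box k], where the
    hypothesis on [P] applies. *)
Lemma joint_decoupled_box (r : nat) :
  (forall A : {fset site d}, (r < diam A)%N -> forall xi, Phi A xi = 0) ->
  joint_measure P Phi bc K -> translation_invariant K ->
  exists2 C : R, 0 < C & forall (n k : nat) (c : R), (n + r <= k)%N ->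
    (forall X M z, (X `<=` box d (n + r))%fset -> [disjoint M & box d k]%fset ->
      pr P (X `|` M)%fset z <= expR c * (pr P X z * pr P M z)) ->
    forall V xi, [disjoint V & box d (k + r)]%fset ->
      pr K (box d n `|` V)%fset xi <=
      C ^+ (3 * (#|` box d (k + r)| - #|` box d n|)) * expR c *
        (pr K (box d n) xi * pr K V xi).
Proof.
move=> Phi_range KP Kinv.
have [C C0 ratio] := uniform_spin_ratio Phi_range KP Kinv.
have E0 : (0 < #|E|)%N by apply/card_gt0P; exists point.
exists (#|E|%:R * C) => [|n k c nk dec V xi dV]; first by rewrite mulr_gt0// ltr0n.
have nkr : (n <= k + r)%N by rewrite (leq_trans (leq_addr r n))// (leq_trans nk)// leq_addr.
set U := box d (k + r) in dV *; set D := (U `\` box d n)%fset.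
have UE : U = (D `|` box d n)%fset by rewrite fsetUC -fset_splitl// box_subset.
have [L [UL LK]] := joint_measure_cvg KP U.
have cv0 W : (fun N => pr (quenched_joint P Phi (L N) bc) W xi) @ \oo --> pr K W xi.
  exact: LK.
set kappa := _ * expR c.
have cv : (fun N => kappa * (pr (quenched_joint P Phi (L N) bc) (box d n) xi *
    pr (quenched_joint P Phi (L N) bc) V xi)) @ \oo -->
    kappa * (pr K (box d n) xi * pr K V xi).
  by apply: cvgM; [exact: cvg_cst|exact: cvgM].
rewrite -(cvg_lim _ cv)// -(cvg_lim _ (cv0 _))//.
apply: ler_lim; [exact: cvgP (cv0 _)|exact: cvgP cv|].
near=> N.
have ULN : (U `<=` L N)%fset by near: N.
set L2 := (L N `\` U)%fset.
have LE : L N = (D `|` (box d n `|` L2))%fset by rewrite fsetUA -UE; exact: fset_splitl.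
have dL2 : [disjoint L2 & U]%fset by apply/fdisjointP => x; rewrite inE => /andP[].
rewrite LE.
have -> : kappa = ((#|E| ^ #|` D|)%:R * C ^+ #|` D|) ^+ 3 * expR c.
  rewrite /kappa natrX -exprMn -exprM mulnC; congr (_ ^+ (_ * _) * _).
  by rewrite /D cardfsD; congr (_ - _)%N; congr (#|` _|); apply/esym/fsetIidPr; exact: box_subset.
apply: (quenched_decoupled Phi_range (W := nbhd r D) bc (t := bc) (n := n + r) (k := k)).
- rewrite fdisjointXU; apply/andP; split; first by apply/fdisjointP => x; rewrite inE => /andP[].
  by rewrite fdisjoint_sym; apply: fdisjointWr dL2; exact: fsubsetDl.
- rewrite fdisjoint_sym; apply: fdisjointWr dL2.
  apply: fsubset_trans (nbhd_box _ _ _) _; apply: box_subset; exact: leq_trans (leq_addr _ _).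
- by rewrite -UE.
- exact: nbhd_box.
- exact: nk.
- rewrite fdisjointUX nbhd_disjoint_box// andbT; apply: fdisjointWr dV.
  by apply: box_subset; exact: leq_addr.
- exact: dec.
- by rewrite exprn_ge0// ltW.
- move=> eta sigma etaW; rewrite -LE.
  apply: (@overwrite_bound _ _ _ D (fun z => weight Phi (L N) (joint z eta)) bc C sigma).
    exact: ltW.
  move=> x z xD; apply: (weight_bounded_sub Phi_range (W := [fset x]%fset)).
  + by apply/fsubsetP => y; rewrite inE => /eqP ->; apply: (fsubsetP ULN); rewrite UE inE xD.
  + by move=> y yx; rewrite /joint overwrite_out.
  + apply: ratio; apply: lt_le_trans etaW _; apply: pr_sub; apply: nbhd_sub.
    by apply/fsubsetP => y; rewrite inE => /eqP ->.
Unshelve. all: by end_near.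
Qed.

End JointDecoupling.

(** * Superadditivity of the relative entropy *)

Section EntropyTerms.
Variable R : realType.
Implicit Types p q a b c : R.

(** The inequality ln x <= x - 1 in the form used for entropies. *)
Lemma mul_ln_ratio_ge p q : 0 <= p -> 0 <= q -> (q = 0 -> p = 0) ->
  p - q <= p * ln (p / q).
Proof.
rewrite le_eqVlt => /orP[/eqP <- q0 _|p0]; first by rewrite sub0r mul0r oppr_le0.
rewrite le_eqVlt => /orP[/eqP <- /(_ erefl) p0'|q0 _]; first by rewrite p0' ltxx in p0.
have qp : 0 < q / p by rewrite divr_gt0.
have -> : p / q = (q / p)^-1 by rewrite invf_div.
rewrite lnV ?posrE// mulrN lerNr opprB.
have lnqp : ln (q / p) <= q / p - 1.
  by rewrite -[in leLHS](subrK 1 (q / p)) addrC le_ln1Dx// ltrBrDl subrr.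
have -> : q - p = p * (q / p - 1).
  by rewrite mulrBr mulr1 mulrCA divff ?gt_eqF// mulr1.
by rewrite ler_pM2l.
Qed.

(** Pointwise form of superadditivity. Summed over patterns, [p - a * b]
    vanishes when [p] is a joint law with marginals [a] and [b]. *)
Lemma ln_ratio_super p q a b qa qb c : 0 <= a -> 0 <= b ->
  0 <= p <= a -> p <= b -> 0 <= q <= qa -> q <= qb -> (q = 0 -> p = 0) ->
  q <= expR c * (qa * qb) ->
  p * ln (a / qa) + p * ln (b / qb) - p * c + (p - a * b) <= p * ln (p / q).
Proof.
move=> a0 b0 /andP[]; rewrite le_eqVlt => /orP[/eqP <- _ _ _ _ _ _|p0 pa pb].
  by rewrite !mul0r !add0r oppr0 add0r oppr_le0 mulr_ge0.
move=> /andP[]; rewrite le_eqVlt => /orP[/eqP <- _ _ /(_ erefl) pp|q0 qqa qqb _ qc].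
  by rewrite pp ltxx in p0.
have [a1 b1] := (lt_le_trans p0 pa, lt_le_trans p0 pb).
have [qa1 qb1] := (lt_le_trans q0 qqa, lt_le_trans q0 qqb).
have ab1 := mulr_gt0 a1 b1.
have : p - a * b <= p * ln (p / (a * b)).
  by apply: mul_ln_ratio_ge; rewrite ?ltW// => ab; rewrite ab ltxx in ab1.
have : p * ln q <= p * (c + (ln qa + ln qb)).
  rewrite ler_pM2l// -lnM ?posrE// -{1}(expRK c) -lnM ?posrE ?expR_gt0 ?mulr_gt0//.
  by rewrite ler_ln ?posrE ?mulr_gt0 ?expR_gt0.
rewrite !ln_div ?posrE ?mulr_gt0// lnM ?posrE//; lra.
Qed.

(** Pointwise form of monotonicity. Summed over patterns, the term in brackets is
    nonnegative. *)
Lemma ln_ratio_mono p q a qa : 0 <= p <= a -> 0 <= q <= qa -> (q = 0 -> p = 0) ->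
  p * ln (a / qa) + (p - q * (a / qa)) <= p * ln (p / q).
Proof.
move=> /andP[]; rewrite le_eqVlt => /orP[/eqP <-|p0 pa].
  move=> a0 /andP[q0 qa0] _; rewrite !mul0r !add0r oppr_le0.
  by rewrite mulr_ge0// divr_ge0// (le_trans q0).
move=> /andP[]; rewrite le_eqVlt => /orP[/eqP <- _ /(_ erefl) pp|q0 qqa _].
  by rewrite pp ltxx in p0.
have a1 := lt_le_trans p0 pa; have qa1 := lt_le_trans q0 qqa.
have x0 : 0 < q * (a / qa) by rewrite mulr_gt0// divr_gt0.
have : p - q * (a / qa) <= p * ln (p / (q * (a / qa))).
  by apply: mul_ln_ratio_ge; rewrite ?ltW// => xx; rewrite xx ltxx in x0.
rewrite !ln_div ?posrE ?divr_gt0// lnM ?posrE ?divr_gt0// ln_div ?posrE//; lra.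
Qed.

End EntropyTerms.

Lemma grid_separated (l : nat) (u v y : int) :
  (`|y - u *+ (l + l).+1| <= l)%N -> (`|y - v *+ (l + l).+1| <= l)%N -> v = u.
Proof.
rewrite -(mulr_natr u) -(mulr_natr v); set N : int := _%:R.
have NE : N = (l + l).+1%:Z by rewrite /N natz.
have mono (a b : int) : a < b -> a * N + N <= b * N.
  by rewrite -lezD1 => ab; rewrite -[X in _ + X]mul1r -mulrDl ler_wpM2r// NE.
case: (ltgtP v u) => // /mono.
  by move: (u * N) (v * N) => a b; rewrite NE; lia.
by move: (u * N) (v * N) => a b; rewrite NE; lia.
Qed.

Lemma grid_bounded (k l m : nat) (u y : int) : (`|u| <= k)%N ->
  (`|y - u *+ (l + l).+1| <= l)%N -> (k * (l + l).+1 + l <= m)%N -> (`|y| <= m)%N.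
Proof.
rewrite -mulr_natr natz => uk yl km.
have : (`|(u * (l + l).+1%:Z)%R| <= k * (l + l).+1)%N.
  by rewrite abszM leq_mul2r uk orbT.
by move: yl; move: (u * _) => a; lia.
Qed.

Section Entropy.
Variables (R : realType) (d : nat) (S : pfinType).
Variables K K' : probability (config d S) R.
Implicit Types (L M W V : {fset site d}).

Definition entropy W : R := expect K W (fun z => ln (pr K W z / pr K' W z)).

Lemma depends_on_ln_ratio L : depends_on L (fun z => ln (pr K L z / pr K' L z)).
Proof. by move=> z z' e; rewrite !(depends_on_pr _ e). Qed.

Lemma relative_entropyE L : marginal_dominated L K K' ->
  relative_entropy L K K' = (entropy L)%:E.
Proof.
move=> dom; rewrite /relative_entropy asboolT//; congr (_%:E).
by apply: eq_bigr => s _; rewrite !(cylinder_agree s point).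
Qed.

Lemma sigma_field_sub (X Y : set (site d)) : X `<=` Y ->
  sigma_field (S := S) X `<=` sigma_field Y.
Proof.
move=> XY; apply: sub_sigma_algebra2 => B [x [a [Xx ->]]].
by exists x, a; split => //; exact: XY.
Qed.

Lemma marginal_dominatedS L W : (L `<=` W)%fset ->
  marginal_dominated W K K' -> marginal_dominated L K K'.
Proof.
move=> /fsubsetP LW dom A LA; apply: dom; apply: sigma_field_sub LA => x /=; exact: LW.
Qed.

Lemma fset_in_box L : exists n, (L `<=` box d n)%fset.
Proof.
exists (\max_(x <- enum_fset L) \max_(i < d) `|x 0%R i|%N).
apply/fsubsetP => x xL; apply/in_boxP => i.
rewrite (big_rem x)//= leq_max; apply/orP; left.
exact: (leq_bigmax (F := fun i => `|x 0%R i|%N)).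
Qed.

Lemma dominated_pr : (forall n, marginal_dominated (box d n) K K') ->
  forall W z, pr K' W z = 0 -> pr K W z = 0.
Proof.
move=> dom W z K'0; have [n /marginal_dominatedS/(_ (dom n)) domW] := fset_in_box W.
apply: EFin_inj; rewrite -prE; apply: domW; first exact: sigma_field_agree.
by rewrite prE K'0.
Qed.

Hypothesis dom : forall W z, pr K' W z = 0 -> pr K W z = 0.

(** Decoupling replaces [K'] by the product of its marginals at the cost [c]; what
    is left over is the relative entropy of the joint law under [K] with respect
    to the product of its marginals, which is nonnegative. *)
Lemma entropy_super L M c : [disjoint L & M]%fset ->
  (forall z, pr K' (L `|` M)%fset z <= expR c * (pr K' L z * pr K' M z)) ->
  entropy L + (entropy M - c) <= entropy (L `|` M)%fset.
Proof.
move=> dLM K'c; set W := (L `|` M)%fset.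
have LW : (L `<=` W)%fset by exact: fsubsetUl.
have MW : (M `<=` W)%fset by exact: fsubsetUr.
have -> : entropy L + (entropy M - c) = spin_sum W (fun z =>
    pr K W z * ln (pr K L z / pr K' L z) + pr K W z * ln (pr K M z / pr K' M z) +
    (- c * pr K W z) + (pr K W z + (-1) * (pr K L z * pr K M z))) point.
  rewrite !spin_sumD !spin_sumZ pr_total.
  rewrite (@spin_sum_prod _ _ _ _ _ L M (pr K L) (pr K M))//; last 3 first.
  - by rewrite fdisjoint_sym.
  - exact: depends_on_pr.
  - exact: depends_on_pr.
  rewrite !pr_total /entropy -(expect_indep K LW (depends_on_ln_ratio (L := L))).
  rewrite -(expect_indep K MW (depends_on_ln_ratio (L := M))) /expect; lra.
apply: le_spin_sum => z _.
apply: le_trans (ln_ratio_super (a := pr K L z) (b := pr K M z)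
  (qa := pr K' L z) (qb := pr K' M z) (c := c) _ _ _ _ _ _ _ _); rewrite ?pr_ge0 ?pr_sub//.
- by rewrite le_eqVlt; apply/orP; left; apply/eqP; ring.
- exact: dom.
Qed.

Lemma entropy_mono L W : (L `<=` W)%fset -> entropy L <= entropy W.
Proof.
move=> LW; set rho := fun z => pr K L z / pr K' L z.
have rho_loc : depends_on L rho by move=> z z' e; rewrite /rho !(depends_on_pr _ e).
have rho_le1 : expect K' W rho <= 1.
  rewrite (expect_indep K' LW rho_loc) -(pr_total K L point).
  apply: le_spin_sum => z _; rewrite /rho mulrCA.
  have [->|nz] := eqVneq (pr K' L z) 0; first by rewrite mul0r mulr0 pr_ge0.
  by rewrite divff// mulr1.
apply: (@le_trans _ _ (entropy L + (1 - expect K' W rho))); first by lra.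
have -> : entropy L + (1 - expect K' W rho) = spin_sum W (fun z =>
    pr K W z * ln (rho z) + (pr K W z + (-1) * (pr K' W z * rho z))) point.
  rewrite !spin_sumD !spin_sumZ pr_total.
  by rewrite /entropy -(expect_indep K LW (depends_on_ln_ratio (L := L))) /expect mulN1r.
apply: le_spin_sum => z _; rewrite mulN1r.
by apply: ln_ratio_mono; rewrite ?pr_ge0 ?pr_sub//; exact: dom.
Qed.

Lemma spin_sum_translate z L (g : config d S -> R) xi :
  spin_sum (translate z L) (fun s => g (shift z s)) xi = spin_sum L g (shift z xi).
Proof.
rewrite /spin_sum (reindex (fun s : {ffun L -> S} =>
  pattern (translate z L) (shift (- z) (glue s (shift z xi))))) /=; last first.
  exists (fun s => pattern L (shift z (glue s xi))) => s _.
    apply/ffunP => x; rewrite ffunE glue_pattern /shift overwrite_in.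
      by rewrite addrK glue_in.
    by rewrite mem_translate addrK fsvalP.
  apply/ffunP => x; rewrite ffunE glue_pattern /shift overwrite_in.
    by rewrite subrK glue_in.
  by rewrite -mem_translate fsvalP.
apply: eq_bigr => s _; congr g; apply/funext => x.
rewrite /shift glue_pattern /overwrite mem_translate !addrK.
by case: ifPn => // xL; rewrite glue_out.
Qed.

Hypotheses (Kinv : translation_invariant K) (K'inv : translation_invariant K').

Lemma entropy_translate z L : entropy (translate z L) = entropy L.
Proof.
rewrite /entropy /expect.
under eq_spin_sum do rewrite !pr_translate//.
rewrite (@spin_sum_translate z L (fun y => pr K L y * ln (pr K L y / pr K' L y))).
apply: eq_bigr => s _; have e x : x \in L -> glue s (shift z point) x = glue s point x.
  by move=> xL; rewrite -[x]/(val [` xL]%fset) !glue_in.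
by rewrite !(depends_on_pr _ e).
Qed.

Lemma decoupled_translate (n l : nat) (c : R) :
  (forall V xi, [disjoint V & box d l]%fset -> pr K' (box d n `|` V)%fset xi <=
     expR c * (pr K' (box d n) xi * pr K' V xi)) ->
  forall z V xi, [disjoint V & translate z (box d l)]%fset ->
    pr K' (translate z (box d n) `|` V)%fset xi <=
    expR c * (pr K' (translate z (box d n)) xi * pr K' V xi).
Proof.
move=> dec z V xi dV.
have VE : V = translate z (translate (- z) V).
  by apply/fsetP => x; rewrite !mem_translate opprK subrK.
have -> : (translate z (box d n) `|` V)%fset =
    translate z (box d n `|` translate (- z) V)%fset.
  by apply/fsetP => x; rewrite !(inE, mem_translate) opprK subrK.
have -> : pr K' V xi = pr K' (translate (- z) V) (shift z xi).
  by rewrite {1}VE (pr_translate z).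
rewrite !(pr_translate z)//; apply: dec.
apply/fdisjointP => x; rewrite mem_translate opprK => xV.
by move/fdisjointP: dV => /(_ _ xV); rewrite mem_translate addrK.
Qed.

(** Translates of [box n] along the grid of step [2 * l + 1] are added one by one;
    each lies in a translate of [box l] disjoint from all the earlier ones, so
    that each addition costs [c]. *)
Lemma packing (n l : nat) (c : R) (J : {fset site d}) : (n <= l)%N ->
  (forall V xi, [disjoint V & box d l]%fset -> pr K' (box d n `|` V)%fset xi <=
     expR c * (pr K' (box d n) xi * pr K' V xi)) ->
  exists2 W, #|` J|%:R * (entropy (box d n) - c) <= entropy W &
    forall x, x \in W -> exists2 j, j \in J & x - j *+ (l + l).+1 \in box d n.
Proof.
move=> nl dec; have decz := decoupled_translate dec.
elim/finSet_rect: J => J IH.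
have [->|[j jJ]] := fset_0Vmem J.
  exists fset0 => [|x]; last by rewrite inE.
  rewrite cardfs0 mul0r /entropy /expect spin_sum0 !pr_fset0 divr1 ln1 mulr0//.
have [W HW WJ] := IH _ (fproperD1 jJ).
set B := translate (j *+ (l + l).+1) (box d n).
have dW : [disjoint W & translate (j *+ (l + l).+1) (box d l)]%fset.
  apply/fdisjointP => x xW; apply/negP; rewrite mem_translate => xj.
  have [j' ] := WJ _ xW; rewrite !inE => /andP[/eqP jj' _] xj'.
  apply: jj'; apply/rowP => i; move/in_boxP/(_ i): xj; move/in_boxP/(_ i): xj'.
  rewrite !mxE !mulmxnE => xj' xj; apply: (grid_separated xj).
  exact: leq_trans nl.
exists (B `|` W)%fset => [|x].
  rewrite (cardfsD1 j) jJ add1n -addn1 natrD mulrDl mul1r addrC.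
  apply: le_trans (entropy_super (c := c) _ _); last first.
  - by move=> z; exact: decz.
  - rewrite fdisjoint_sym; apply: fdisjointWr dW; apply/fsubsetP => x.
    by rewrite !mem_translate; apply/fsubsetP; exact: box_subset.
  - rewrite /B entropy_translate; lra.
rewrite inE mem_translate => /orP[xB|/WJ[j']]; first by exists j.
by rewrite inE => /andP[_ j'J]; exists j'.
Qed.

Lemma entropy_box_ge (n l k m : nat) (c : R) : (n <= l)%N ->
  (forall V xi, [disjoint V & box d l]%fset -> pr K' (box d n `|` V)%fset xi <=
     expR c * (pr K' (box d n) xi * pr K' V xi)) ->
  (k * (l + l).+1 + l <= m)%N ->
  ((k + k).+1 ^ d)%:R * (entropy (box d n) - c) <= entropy (box d m).
Proof.
move=> nl dec km; have [W HW Wk] := packing (box d k) nl dec.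
rewrite -card_box; apply: (le_trans HW); apply: entropy_mono.
apply/fsubsetP => x /Wk[j /in_boxP jk /in_boxP xj]; apply/in_boxP => i.
apply: grid_bounded (jk i) _ km; have := xj i; rewrite !mxE mulmxnE => h.
exact: leq_trans nl.
Qed.

End Entropy.

(** * Convergence of the densities *)

Section Limits.
Variable R : realType.
Implicit Types (a b theta eps : nat -> R).

(** The lower limit of [a] is at least the supremum [s] of [b]; conversely
    [a n = b n / theta n + eps n <= s / theta n + eps n], whose limit is [s]. If
    [b] is unbounded, the limit is infinite. *)
Lemma cvg_self_improving a b theta eps :
  theta @ \oo --> (1 : R) -> eps @ \oo --> (0 : R) ->
  (forall n, b n = theta n * (a n - eps n)) ->
  (forall n e, 0 < e -> \forall m \near \oo, b n - e <= a m) ->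
  exists h : \bar R, (fun m => (a m)%:E) @ \oo --> h.
Proof.
move=> theta1 eps0 bE ab.
have [[B bB]|unb] := pselect (exists B, forall n, b n <= B); last first.
  exists +oo%E; apply/cvgeyPge => A.
  have [n bn] : exists n, A + 1 < b n.
    apply: contrapT => h; apply: unb; exists (A + 1) => n.
    by rewrite leNgt; apply/negP => bn; apply: h; exists n.
  have := ab n 1 ltr01; apply: filterS => m bm; rewrite lee_fin.
  by apply: le_trans bm; rewrite lerBrDr ltW.
have supb : has_sup (range b).
  by split; [exists (b 0), 0|exists B => _ [n _ <-]].
set s := sup (range b).
have bs n : b n <= s by apply: ub_le_sup; [exact: supb.2|exists n].
exists s%:E; apply: cvg_EFin; first exact: nearW.
have upper : (fun m => s / theta m + eps m) @ \oo --> s.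
  suff : (fun m => s / theta m + eps m) @ \oo --> s / 1 + 0 by rewrite divr1 addr0.
  by apply: cvgD => //; apply: cvgM; [exact: cvg_cst|apply: cvgV => //; exact: oner_neq0].
apply/cvgrPdist_le => e e0; near=> m.
rewrite ler_distlC; apply/andP; split.
  near: m.
  have [_ [n _ <-]] := sup_adherent (divr_gt0 e0 (ltr0n _ 2)) supb.
  rewrite -/s => bn; have := ab n (e / 2) (divr_gt0 e0 (ltr0n _ 2)).
  by apply: filterS => m bm; apply: le_trans bm; lra.
have th0 : 0 < theta m.
  by near: m; apply: (cvgr_gt (1 : R)).
apply: (@le_trans _ _ (s / theta m + eps m)).
  by rewrite -lerBlDr ler_pdivlMr// mulrC -bE.
by near: m; apply: (cvgr_le s) => //; rewrite ltrDl.
Unshelve. all: by end_near.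
Qed.

Lemma cvg_expr1 (d : nat) a : a @ \oo --> (1 : R) ->
  (fun n => a n ^+ d) @ \oo --> (1 : R).
Proof.
move=> a1; have := @cvg_comp _ _ _ a (fun x : R => x ^+ d) _ _ _ a1
  (@exprn_continuous R d 1).
by rewrite expr1n.
Qed.

Lemma odd_gt0 n : 0 < (n + n).+1%:R :> R. Proof. exact: ltr0n. Qed.

Lemma cvg_inv_odd : (fun n => (n + n).+1%:R^-1 : R) @ \oo --> (0 : R).
Proof.
apply: (squeeze_cvgr (f := fun=> 0) (h := harmonic)).
- by apply: nearW => n /=; rewrite invr_ge0 ler0n lef_pV2 ?posrE// ler_nat ltnS leq_addr.
- exact: cvg_cst.
- exact: cvg_harmonic.
Qed.

Lemma cvg_odd_ratio (s : nat -> nat) :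
  (fun n => (s n)%:R / (n + n).+1%:R : R) @ \oo --> (0 : R) ->
  (fun n => (n + s n + (n + s n)).+1%:R / (n + n).+1%:R : R) @ \oo --> (1 : R).
Proof.
move=> s0; have : (fun n => 1 + 2 * ((s n)%:R / (n + n).+1%:R : R)) @ \oo --> (1 + 2 * 0 : R).
  by apply: cvgD; [exact: cvg_cst|apply: cvgM => //; exact: cvg_cst].
rewrite mulr0 addr0; apply: cvg_trans; apply: near_eq_cvg; apply: nearW => n.
have -> : (n + s n + (n + s n)).+1%:R = (n + n).+1%:R + 2 * (s n)%:R :> R.
  by rewrite -natrM -natrD; congr (_%:R); lia.
by rewrite [RHS]mulrDl divff ?gt_eqF// mulrA.
Qed.

Lemma cvg_const_ratio (r : nat) :
  (fun n => r%:R / (n + n).+1%:R : R) @ \oo --> (0 : R).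
Proof.
by rewrite -(mulr0 r%:R); apply: cvgM; [exact: cvg_cst|exact: cvg_inv_odd].
Qed.

Lemma cvg_gap_ratio (r : nat) (g : nat -> nat) :
  (fun n => (g n)%:R / n%:R : R) @ \oo --> (0 : R) ->
  (fun n => (r + r + g (n + r))%:R / (n + n).+1%:R : R) @ \oo --> (0 : R).
Proof.
move=> g0.
have half : (fun n => (n + r)%:R / (n + n).+1%:R : R) @ \oo --> ((1 - 0) / 2 : R).
  have : (fun n => ((n + r + (n + r)).+1%:R / (n + n).+1%:R - (n + n).+1%:R^-1) / 2 : R)
      @ \oo --> ((1 - 0) / 2 : R).
    apply: cvgM; last exact: cvg_cst.
    by apply: cvgB; [exact/cvg_odd_ratio/cvg_const_ratio|exact: cvg_inv_odd].
  apply: cvg_trans; apply: near_eq_cvg; apply: nearW => n /=.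
  have -> : (n + r + (n + r)).+1%:R = 2 * (n + r)%:R + 1 :> R.
    by rewrite -natrM -natr1; congr (_ + _); congr (_%:R); lia.
  move: (odd_gt0 n); move: ((n + n).+1%:R : R) ((n + r)%:R : R) => x y x0.
  by field; rewrite gt_eqF.
have gr : (fun n => (g (n + r)%N)%:R / (n + r)%:R : R) @ \oo --> (0 : R).
  by rewrite (cvg_shiftn r (fun n => (g n)%:R / n%:R : R)).
have : (fun n => (r + r)%:R / (n + n).+1%:R +
    (g (n + r)%N)%:R / (n + r)%:R * ((n + r)%:R / (n + n).+1%:R) : R) @ \oo -->
    (0 + 0 * ((1 - 0) / 2) : R).
  by apply: cvgD; [exact: cvg_const_ratio|apply: cvgM].
rewrite mul0r addr0; apply: cvg_trans; apply: near_eq_cvg.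
near=> n; rewrite /= [in RHS]natrD [RHS]mulrDl; congr (_ + _).
rewrite mulrA divfK// pnatr_eq0 -lt0n addn_gt0; apply/orP; left.
by near: n; exact: nbhs_infty_gt.
Unshelve. all: by end_near.
Qed.

(** The grid of step [2 * l + 1] fills [box m] up to a boundary layer of bounded
    width. *)
Lemma cvg_packing_ratio (l : nat) :
  (fun m => (((m - l) %/ (l + l).+1 + (m - l) %/ (l + l).+1).+1%:R * (l + l).+1%:R)
     / (m + m).+1%:R : R) @ \oo --> (1 : R).
Proof.
pose N := (l + l).+1.
apply: (squeeze_cvgr (f := fun m => 1 - (N + N)%:R / (m + m).+1%:R) (h := fun=> 1)).
- near=> m; have lm : (l <= m)%N by near: m; exact: nbhs_infty_ge.
  have mE := divn_eq (m - l) N; have mod_lt : ((m - l) %% N < N)%N by rewrite ltn_mod.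
  set k := ((m - l) %/ N)%N in mE *; rewrite -natrM.
  rewrite ler_pdivlMr// mulrBl mul1r divfK ?gt_eqF// ler_pdivrMr// mul1r.
  rewrite lerBlDr -natrD !ler_nat.
  by move: mE mod_lt; rewrite /N; move: (_ %% _)%N => s; nia.
- rewrite -[X in _ --> X]subr0; apply: cvgB; [exact: cvg_cst|exact: cvg_const_ratio].
- exact: cvg_cst.
Unshelve. all: by end_near.
Qed.

End Limits.

Theorem corollary1 (R : realType) (d : nat) (E E' : pfinType)
    (P : probability (config d E') R)
    (Phi : finite_range_potential R d E E')
    (bc : config d E)
    (Kbc : probability (config d (E * E')%type) R) :
  asymptotically_decoupled P ->
  joint_measure P Phi bc Kbc ->
  translation_invariant Kbc ->
  forall K : probability (config d (E * E')%type) R,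
    translation_invariant K ->
    exists h : \bar R, has_relative_entropy_density K Kbc h.
Proof.
move=> [_ [g [c [c0 g0 dec]]]] KbcP Kbcinv K Kinv; rewrite /has_relative_entropy_density.
have [[n ndom]|alldom] := pselect (exists n, ~ marginal_dominated (box d n) K Kbc).
  (* Domination on a box implies domination on every smaller one, so all large
     boxes have infinite relative entropy. *)
  exists +oo%E; apply: cvg_near_cst; near=> m.
  have nm : (n <= m)%N by near: m; exact: nbhs_infty_ge.
  rewrite /relative_entropy asboolF; last first.
    by move=> /(marginal_dominatedS (box_subset d nm)).
  by rewrite gt0_muley// lte_fin invr_gt0 card_box ltr0n expn_gt0.
have {}alldom n : marginal_dominated (box d n) K Kbc.
  by apply: contrapT => ndom; apply: alldom; exists n.
have dom := dominated_pr alldom.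
have [r Phi_range] := pot_finite_range Phi.
have [C C0 decK] := joint_decoupled_box Phi_range KbcP Kbcinv.
(* [k n] leaves the decoupling gap around [box (n + r)], and [l n] adds one more
   interaction range for the outer part. *)
pose k n := (n + r + g (n + r))%N; pose l n := (n + (r + r + g (n + r)))%N.
have lE n : (k n + r = l n)%N by rewrite /k /l; lia.
pose vol n : R := (n + n).+1%:R ^+ d.
have vol0 n : 0 < vol n by rewrite exprn_gt0.
have volE n : #|` box d n|%:R = vol n by rewrite card_box natrX.
pose c' n := ((3 * (#|` box d (l n)| - #|` box d n|))%N)%:R * ln C + c (n + r)%N.
have dec' n V xi : [disjoint V & box d (l n)]%fset ->
    pr Kbc (box d n `|` V)%fset xi <=
    expR (c' n) * (pr Kbc (box d n) xi * pr Kbc V xi).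
  rewrite /c' expRD expRM_natl lnK ?posrE// -lE => dV.
  apply: decK => //; first exact: leq_addr.
  move=> X M z; apply: decoupled_pr => A B; exact: dec.
have nl n : (n <= l n)%N by exact: leq_addr.
pose a m := entropy K Kbc (box d m) / vol m.
pose theta n := vol n / vol (l n).
pose eps n := c' n / vol n.
have [h ah] : exists h : \bar R, (fun m => (a m)%:E) @ \oo --> h.
  have vratio (s : nat -> nat) : (fun n => (s n)%:R / (n + n).+1%:R : R) @ \oo --> (0 : R) ->
      (fun n => vol (n + s n)%N / vol n) @ \oo --> (1 : R).
    move=> /cvg_odd_ratio/(cvg_expr1 d).
    by apply: cvg_trans; apply: near_eq_cvg; apply: nearW => n /=; rewrite /vol expr_div_n.
  have lratio : (fun n => vol (l n) / vol n) @ \oo --> (1 : R).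
    exact/vratio/cvg_gap_ratio.
  apply: (@cvg_self_improving _ a
    (fun n => (entropy K Kbc (box d n) - c' n) / vol (l n)) theta eps).
  - have : (fun n => (vol (l n) / vol n)^-1) @ \oo --> (1^-1 : R).
      by apply: cvgV => //; exact: oner_neq0.
    rewrite invr1.
    by apply: cvg_trans; apply: near_eq_cvg; apply: nearW => n; rewrite /theta /= invf_div.
  - have cr : (fun n => c (n + r)%N / vol (n + r)%N) @ \oo --> (0 : R).
      rewrite (cvg_shiftn r (fun n => c n / vol n)); move: c0.
      by apply: cvg_trans; apply: near_eq_cvg; apply: nearW => n; rewrite volE.
    have : (fun n => 3 * ln C * (vol (l n) / vol n - 1) +
        c (n + r)%N / vol (n + r)%N * (vol (n + r)%N / vol n)) @ \oo -->
        (3 * ln C * (1 - 1) + 0 * 1 : R).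
      apply: cvgD.
        by apply: cvgM; [exact: cvg_cst|apply: cvgB => //; exact: cvg_cst].
      by apply: cvgM => //; exact: (vratio (fun=> r) (@cvg_const_ratio R r)).
    rewrite subrr mulr0 mul0r addr0; apply: cvg_trans; apply: near_eq_cvg.
    apply: nearW => n; rewrite /eps /c' natrM natrB ?volE /=; last first.
      by apply: fsubset_leq_card; exact: box_subset.
    by field; rewrite !gt_eqF.
  - by move=> n; rewrite /theta /a /eps; field; rewrite !gt_eqF.
  - move=> n e e0; set b := _ / vol (l n).
    have rho : (fun m => vol ((m - l n) %/ (l n + l n).+1)%N * vol (l n) / vol m * b)
        @ \oo --> (1 * b : R).
      apply: cvgM; last exact: cvg_cst.
      have := cvg_expr1 d (@cvg_packing_ratio R (l n)).
      apply: cvg_trans; apply: near_eq_cvg; apply: nearW => m /=.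
      by rewrite /vol expr_div_n exprMn.
    near=> m; apply: (@le_trans _ _ (vol ((m - l n) %/ (l n + l n).+1)%N * vol (l n) / vol m * b)).
      by near: m; apply: (cvgr_ge _ rho); rewrite mul1r ltrBlDr ltrDl.
    have lm : (l n <= m)%N by near: m; exact: nbhs_infty_ge.
    rewrite /a ler_pdivlMr//.
    have -> : vol ((m - l n) %/ (l n + l n).+1)%N * vol (l n) / vol m * b * vol m =
        vol ((m - l n) %/ (l n + l n).+1)%N * (entropy K Kbc (box d n) - c' n).
      by rewrite /b; field; rewrite !gt_eqF.
    rewrite {1}/vol -natrX; apply: (entropy_box_ge dom Kinv Kbcinv (nl n) (dec' n)).
    by rewrite addnC -leq_subRL// leq_trunc_div.
exists h; move: ah; apply: cvg_trans; apply: near_eq_cvg; apply: nearW => m.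
by rewrite relative_entropyE// volE -EFinM mulrC.
Unshelve. all: by end_near.
Qed.
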